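(* Let $0\le s<\tfrac32$. For every $\epsilon>0$ the 2D Euler system in the periodic channel $\mathbb{T}\times[-1,1]$ (with slip boundary condition and circulation $\int_{-1}^1u_1\,dy=\tfrac23$) admits a nontrivial traveling wave solution, with profile vorticity $\omega\in W^{1,\infty}(\mathbb{T}\times[-1,1])$ and speed parameter $\lambda\in\mathbb{R}$, such that $$\|\omega+2y\|_{H^s(\mathbb{T}\times[-1,1])}<\epsilon ,$$ and whose speed is $O(1)$ with respect to $\epsilon$, i.e. the solutions can be chosen so that $|\lambda|\le C$ with $C$ independent of $\epsilon$.
   Context: $\mathbb{T}=\mathbb{R}/2\pi\mathbb{Z}$. The 2D Euler system is $\partial_t\mathbf{u}+(\mathbf{u}\cdot\nabla)\mathbf{u}=-\nabla p$, $\nabla\cdot\mathbf{u}=0$ in $\mathbb{T}\times[-1,1]$, with $u_2|_{y=\pm1}=0$ and $\int_{-1}^1u_1(x,y,t)\,dy=\tfrac23$ for all $t\ge 0$. The Poiseuille flow $\mathbf{u}_P=(y^2,0)$ is a stationary solution with vorticity $-2y$. Vorticity formulation: $\partial_t\omega+\mathbf{u}\cdot\nabla\omega=0$, where $\mathbf{u}=\nabla^\perp\Psi=(-\partial_y\Psi,\partial_x\Psi)$, $\Delta\Psi=\omega$ in $\mathbb{T}\times[-1,1]$, $\Psi|_{y=\pm1}=\mp\tfrac13$. For Lipschitz vorticities the equation is understood in the weak sense: $\int_0^T\int_{\mathbb{T}\times(-1,1)}(\omega\,\partial_t\eta+\omega\,\mathbf{u}\cdot\nabla\eta)\,dx\,dy\,dt=0$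 for all $\eta\in C_c^\infty(\mathbb{T}\times(-1,1)\times(0,T))$ and all $T>0$. A traveling wave solution with profile vorticity $\omega(x,y)$ and speed parameter $\lambda\in\mathbb{R}$ means that $(x,y,t)\mapsto\omega(x+\lambda t,y)$ is a (weak) solution of this system. ''Nontrivial'' means that the velocity is not a shear flow, i.e. the dependence of $u_1$ on the horizontal variable $x$ is nontrivial. *)

(* Defs.v *)
From HB Require Import structures.
From mathcomp Require Import all_boot all_order all_algebra.
From mathcomp Require Import all_classical all_reals all_analysis.

Set Implicit Arguments.
Unset Strict Implicit.
Unset Printing Implicit Defensive.
Import Order.TTheory GRing.Theory Num.Theory.
Import numFieldNormedType.Exports.
Local Open Scope classical_set_scope.
Local Open Scope ring_scope.

(* Functions on the channel T x [-1,1] are functions of (x, y) : R * R that are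
   2pi-periodic in x; their values for |y| > 1 are irrelevant. *)

Definition xperiodic (R : realType) (S : Type) (f : R * R -> S) : Prop :=
  forall x y, f (x + 2 * pi, y) = f (x, y).

Definition open_channel (R : realType) : set (R * R) :=
  [set z | -1 < z.2 < 1].

Definition closed_channel (R : realType) : set (R * R) :=
  [set z | -1 <= z.2 <= 1].

(* Fundamental domain of T x [-1,1], with which integrals over T x [-1,1] and
   over T x (-1,1) are computed. *)
Definition cell (R : realType) : set (R * R) := `[0, 2 * pi[ `*` `[-1, 1].

Definition leb2 (R : realType) :=
  ((@lebesgue_measure R) \x (@lebesgue_measure R))%E.

Arguments open_channel : clear implicits.
Arguments closed_channel : clear implicits.
Arguments cell : clear implicits.
Arguments leb2 : clear implicits.

Definition dirx (R : realType) : R * R := (1, 0).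
Definition diry (R : realType) : R * R := (0, 1).

(* C^k regularity on an open set D. *)
Fixpoint Ck_on (R : realType) (V : normedModType R) (D : set V) (k : nat)
    (f : V -> R) : Prop :=
  (forall z, D z -> {for z, continuous f}) /\
  (if k is k'.+1 then
     forall v : V, (forall z, D z -> derivable f z v) /\ Ck_on D k' ('D_v f)
   else True).

Definition smooth (R : realType) (V : normedModType R) (f : V -> R) : Prop :=
  forall k, Ck_on setT k f.

(* eta in C_c^oo(T x (-1,1)) *)
Definition test_fun (R : realType) (eta : R * R -> R) : Prop :=
  [/\ smooth eta, xperiodic eta &
      exists2 d : R, 0 < d &
        forall x y, eta (x, y) != 0 -> -1 + d <= y <= 1 - d].

(* eta in C_c^oo(T x (-1,1) x (0,T)), with arguments ((x, y), t) *)
Definition test_fun_time (R : realType) (T : R) (eta : R * R * R -> R) : Prop :=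
  [/\ smooth eta, (forall t, xperiodic (fun z => eta (z, t))) &
      exists2 d : R, 0 < d &
        forall x y t, eta (x, y, t) != 0 ->
          -1 + d <= y <= 1 - d /\ d <= t <= T - d].

(* g is the weak partial derivative of f in the direction e on T x (-1,1).
   Both functions are required to be in L^1 of the channel, which loses nothing
   for derivatives in L^2 or L^oo since the channel has finite area. *)
Definition weak_partial (R : realType) (e : R * R) (f g : R * R -> R) : Prop :=
  [/\ (leb2 R).-integrable (cell R) (EFin \o f),
      (leb2 R).-integrable (cell R) (EFin \o g) &
      forall eta, test_fun eta ->
        \int[leb2 R]_(z in cell R) (f z * 'D_e eta z) =
        - \int[leb2 R]_(z in cell R) (g z * eta z)].

Definition ess_bounded (R : realType) (f : R * R -> R) : Prop :=
  measurable_fun (cell R) f /\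
  exists M : R, {ae leb2 R, forall z, cell R z -> `|f z| <= M}.

(* W^{1,oo}(T x [-1,1]) *)
Definition W1infty (R : realType) (f : R * R -> R) : Prop :=
  [/\ xperiodic f, ess_bounded f &
      exists g1 g2, [/\ weak_partial (dirx R) f g1, weak_partial (diry R) f g2,
                        ess_bounded g1 & ess_bounded g2]].

(* Distance on T x [-1,1], for points of the fundamental domain. *)
Definition channel_dist (R : realType) (z w : R * R) : R :=
  let a := `|z.1 - w.1| in
  Num.sqrt (Num.min a (2 * pi - a) ^+ 2 + (z.2 - w.2) ^+ 2).

Definition L2sq (R : realType) (f : R * R -> R) : \bar R :=
  (\int[leb2 R]_(z in cell R) ((f z) ^+ 2)%:E)%E.

(* Squared Gagliardo seminorm of order 0 < r < 1 in dimension 2. *)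
Definition gagliardo_sq (R : realType) (r : R) (f : R * R -> R) : \bar R :=
  (\int[leb2 R]_(z in cell R) \int[leb2 R]_(w in cell R)
     ((f z - f w) ^+ 2 / channel_dist z w `^ (2 + 2 * r))%:E)%E.

(* Squared Sobolev-Slobodeckij norm of order k + r, with 0 <= r < 1.  Weak
   derivatives being unique almost everywhere, the infimum ranges over at most
   one value; it is +oo when f has no weak gradient. *)
Fixpoint sobolev_sq (R : realType) (k : nat) (r : R) (f : R * R -> R) : \bar R :=
  if k is k'.+1 then
    ereal_inf [set N | exists g1 g2,
      [/\ weak_partial (dirx R) f g1, weak_partial (diry R) f g2 &
          N = (L2sq f + (sobolev_sq k' r g1 + sobolev_sq k' r g2))%E]]
  else if r == 0 then L2sq f
  else (L2sq f + gagliardo_sq r f)%E.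

Definition Hs_norm (R : realType) (s : R) (f : R * R -> R) : \bar R :=
  sqrte (sobolev_sq (Num.truncn s) (s - (Num.truncn s)%:R) f).

(* The Dirichlet problem Delta Psi = w, Psi = -+1/3 on y = +-1, is stated
   classically: for Lipschitz w its solution is C^2 inside and C^1 up to the
   boundary.  The slip condition and the circulation follow from the boundary
   values of Psi, but are listed as part of the system. *)
Definition velocity_of (R : realType) (w : R * R -> R) (u : R * R -> R * R)
    : Prop :=
  [/\ xperiodic u,
      {within closed_channel R, continuous u},
      (forall x, (u (x, 1)).2 = 0 /\ (u (x, -1)).2 = 0),
      (forall x, \int[@lebesgue_measure R]_(y in `[-1, 1]) (u (x, y)).1 = 2 / 3) &
      exists Psi : R * R -> R,
        [/\ xperiodic Psi,
            {within closed_channel R, continuous Psi},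
            (forall x, Psi (x, 1) = - (1 / 3) /\ Psi (x, -1) = 1 / 3),
            Ck_on (open_channel R) 2 Psi &
            forall z, open_channel R z ->
              u z = (- 'D_(diry R) Psi z, 'D_(dirx R) Psi z) /\
              'D_(dirx R) ('D_(dirx R) Psi) z + 'D_(diry R) ('D_(diry R) Psi) z = w z]].

(* Lebesgue integrals of non-integrable functions are junk values, so the weak
   form is meaningful for w and u that are jointly continuous in (x, y, t) on
   |y| < 1, as is the case for traveling waves with a Lipschitz profile. *)
Definition euler_weak_sol (R : realType) (w : R -> R * R -> R)
    (u : R -> R * R -> R * R) : Prop :=
  [/\ (forall t : R, 0 <= t -> W1infty (w t)),
      (forall t : R, 0 <= t -> velocity_of (w t) (u t)) &
      forall (T : R) (eta : R * R * R -> R), 0 < T -> test_fun_time T eta ->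
        \int[@lebesgue_measure R]_(t in `[0, T])
          \int[leb2 R]_(z in cell R)
            (w t z * 'D_(0, 0, 1) eta (z, t)
             + w t z * ((u t z).1 * 'D_(1, 0, 0) eta (z, t)
                        + (u t z).2 * 'D_(0, 1, 0) eta (z, t))) = 0].

Definition shear_flow (R : realType) (u : R -> R * R -> R * R) : Prop :=
  forall t x x' y, 0 <= t -> -1 <= y <= 1 -> (u t (x, y)).1 = (u t (x', y)).1.

Definition nontrivial_traveling_wave (R : realType) (omega : R * R -> R)
    (lambda : R) : Prop :=
  exists u, euler_weak_sol (fun t z => omega (z.1 + lambda * t, z.2)) u
            /\ ~ shear_flow u.

(* Main.v *)
Require Import Defs.
From HB Require Import structures.
From mathcomp Require Import all_boot all_order all_algebra.
From mathcomp Require Import all_classical all_reals all_analysis.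
From mathcomp Require Import measurable_realfun ring lra.

(** The travelling waves are explicit: no bifurcation argument is involved.

    The vorticity [- 2 y] of the Poiseuille flow vanishes on the axis [y = 0], so
    it can be replaced by [- 2 theta y] with [theta] vanishing for [`|y| <= e] and
    of slope one for [2 e <= `|y|] ([theta] is [shear e 2]).  The flow remains a
    shear flow, and it moves the strip [`|y| <= e] rigidly, with some velocity
    [- c].  In the frame moving with this velocity the fluid in the strip is at
    rest.  A region at rest can be filled with any steady flow whose velocity is
    compactly supported in it, for instance a radial vortex, with stream function
    a multiple of [max (e ^ 2 - rho ^ 2) 0 ^ 6], [rho] being the distance to the
    centre.  The sum is steady in the moving frame and depends on [x].  The speed
    parameter is [c = - 1 / 3 + 2 shear e 4 1], which lies in [[- 1 / 3, 0]], and
    the amplitude of the vortex is at our disposal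
    ([traveling_wave_near_Poiseuille]).

    As everything is of class C1, the weak formulation reduces to the pointwise
    steady equation through Fubini's theorem and the vanishing of the integrals of
    the partial derivatives of compactly supported periodic functions
    ([traveling_wave]).

    It remains to measure the perturbation [f = omega + 2 y].  It is of size [e],
    its gradient is of size one, Lipschitz with constant of order [1 / e], and
    supported in [`|y| <= 2 e].  By interpolation the gradient has Hoelder constants
    of order [e ^ (- th)] for every exponent [th] in [[0, 1]], and the strip has
    area of order [e]; so the squared seminorm of order [r] of the gradient is of
    order [e ^ (1 - 2 th)] for every [th] with [r < th] ([gagliardo_bound],
    [slobodeckij_bound]).  Choosing [th < 1 / 2] is possible when [r < 1 / 2], that
    is, for norms of order [s = 1 + r < 3 / 2] ([Hs_norm_small]). *)

Set Implicit Arguments.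
Unset Strict Implicit.
Unset Printing Implicit Defensive.
Import Order.TTheory GRing.Theory Num.Theory.
Import numFieldNormedType.Exports.
Local Open Scope classical_set_scope.
Local Open Scope ring_scope.

(** * Measurability and iterated integrals of continuous functions *)

(** [f] is the pointwise limit of the functions obtained by rounding [t] down to
    a multiple of [1 / n.+1]; each of these glues countably many slices. *)
Lemma caratheodory_measurable d (T : measurableType d) (R : realType)
    (f : T * R -> R) :
  (forall t, measurable_fun [set: T] (fun z => f (z, t))) ->
  (forall z, continuous (fun t => f (z, t))) ->
  measurable_fun [set: T * R] f.
Proof.
move=> mf cf.
pose q (n : nat) (k : int) : R := k%:~R / n.+1%:R.
pose cl n (t : R) := Num.floor (t * n.+1%:R).
pose h n (p : T * R) := f (p.1, q n (cl n p.2)).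
apply: (@measurable_realfun.measurable_fun_cvg _ _ R setT h) => [n|[z t] _].
- move=> _ Y mY; rewrite setTI.
  rewrite (_ : _ @^-1` _ = \bigcup_(k in [set: int])
      (((fun z => f (z, q n k)) @^-1` Y) `*` [set t | cl n t = k])); last first.
    apply/seteqP; split=> [[z t] /= Yt|[z t] [k _ /= [Yt ekt]]].
      by exists (cl n t).
    by rewrite /h /= ekt.
  apply: countable_bigcupT_measurable => [|k]; first exact: countableP.
  apply: measurableX.
    by rewrite -[X in measurable X]setTI; apply: (mf (q n k)).
  rewrite (_ : [set _ | _] = `[q n k, q n (k + 1)[%classic) //.
  apply/seteqP; split=> t /=; rewrite in_itv /= /q /cl.
    move=> <-; rewrite ler_pdivrMr ?ltr_pdivlMr ?ltr0n //.
    exact: Num.Theory.floor_itv.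
  rewrite ler_pdivrMr ?ltr_pdivlMr ?ltr0n // => H.
  exact: Num.Theory.floor_def.
- suff qt : q n (cl n t) @[n --> \oo] --> (t : R^o).
    by have := cvg_comp _ _ qt (cf z t).
  apply/cvgrPdist_lt => e e0.
  have := near_infty_natSinv_lt (PosNum e0); apply: filterS => n /= He.
  apply: le_lt_trans He.
  have n0 : (0 : R) < n.+1%:R by rewrite ltr0n.
  have /andP[H1 H2] := Num.Theory.floor_itv (t * n.+1%:R).
  rewrite /q /cl -[t in t - _](mulfK (lt0r_neq0 n0)) -mulrBl normrM.
  rewrite [X in _ * X]gtr0_norm ?invr_gt0 // -[leRHS]mul1r.
  rewrite ler_pM2r ?invr_gt0 // ger0_norm ?subr_ge0 //.
  by move: H2; rewrite intrD => /ltW; rewrite lerBlDl.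
Qed.

Lemma continuous_pairing (T U V : topologicalType) (f : T -> U) (g : T -> V) :
  continuous f -> continuous g -> continuous (fun x => (f x, g x)).
Proof. by move=> cf cg x; apply: cvg_pair; [exact: cf | exact: cg]. Qed.

Lemma continuous_compf (T U V : topologicalType) (f : T -> U) (g : U -> V) :
  continuous f -> continuous g -> continuous (fun x => g (f x)).
Proof. by move=> cf cg x; apply: continuous_comp; [exact: cf | exact: cg]. Qed.

Lemma continuous_fst (U V : topologicalType) :
  continuous (fun z : U * V => z.1).
Proof. by move=> z; exact: cvg_fst. Qed.

Lemma continuous_snd (U V : topologicalType) :
  continuous (fun z : U * V => z.2).
Proof. by move=> z; exact: cvg_snd. Qed.

Lemma continuous_slice1 (U V W : topologicalType) (f : U * V -> W) (y : V) :
  continuous f -> continuous (fun x => f (x, y)).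
Proof.
move=> cf; apply: (@continuous_compf _ _ _ (fun x => (x, y)) f) => //.
by apply: continuous_pairing => x; [exact: cvg_id | exact: cvg_cst].
Qed.

Lemma continuous_slice2 (U V W : topologicalType) (f : U * V -> W) (x : U) :
  continuous f -> continuous (fun y => f (x, y)).
Proof.
move=> cf; apply: (@continuous_compf _ _ _ (fun y => (x, y)) f) => //.
by apply: continuous_pairing => y; [exact: cvg_cst | exact: cvg_id].
Qed.

Lemma continuous_measurable2 (R : realType) (f : R * R -> R) :
  continuous f -> measurable_fun [set: R * R] f.
Proof.
move=> cf; apply: caratheodory_measurable => [t|x].
  by apply: measurable_realfun.continuous_measurable_fun; exact: continuous_slice1.
exact: continuous_slice2.
Qed.

Lemma compact_bound (R : realType) (T : topologicalType) (f : T -> R)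
    (A : set T) : continuous f -> compact A ->
  exists2 M, 0 <= M & forall z, A z -> `|f z| <= M.
Proof.
move=> cf cA.
have : bounded_set (f @` A).
  by apply: compact_bounded; apply: continuous_compact => //; exact: continuous_subspaceT.
move=> [M [_ HM]]; exists (`|M| + 1) => [|z Az]; first by rewrite addr_ge0.
by apply: (HM (`|M| + 1)) => //=; [rewrite (le_lt_trans (ler_norm M)) ?ltrDl | exists z].
Qed.

Lemma measurable_cell (R : realType) : measurable (cell R).
Proof. by apply: measurableX; exact: measurable_itv. Qed.

Lemma leb2_cell (R : realType) : leb2 R (cell R) = (4 * pi)%:E.
Proof.
rewrite /leb2 product_measure1E //=.
rewrite !lebesgue_measure_itv /= !lte_fin.
rewrite mulr_gt0 ?pi_gt0 // (_ : -1 < 1) ?gtrN //= -!EFinB -EFinM.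
by congr (_%:E); lra.
Qed.

Lemma cell_bound (R : realType) (f : R * R -> R) : continuous f ->
  exists2 M, 0 <= M & forall z, cell R z -> `|f z| <= M.
Proof.
move=> cf; have [|M M0 HM] := @compact_bound R _ f (`[0, 2 * pi] `*` `[-1, 1]) cf.
  by apply: compact_setX; exact: segment_compact.
exists M => // z [/= z1 z2]; apply: HM; split => //=.
by move: z1; rewrite !in_itv /= => /andP[-> /ltW].
Qed.

Lemma continuous_integrable_cell (R : realType) (f : R * R -> R) : continuous f ->
  (leb2 R).-integrable (cell R) (EFin \o f).
Proof.
move=> cf; apply: measurable_bounded_integrable.
- exact: measurable_cell.
- have cell_fin : (leb2 R (cell R) < +oo)%E by rewrite leb2_cell ltry.
  exact: cell_fin.
- by apply: measurable_funTS; exact: continuous_measurable2.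
- have [M M0 HM] := cell_bound cf.
  exists M; split; first exact: num_real.
  by move=> x Mx z cz /=; rewrite (le_trans (HM z cz)) // ltW.
Qed.

Lemma restrict_pair (T1 T2 : Type) (R : realType) (A : set T1) (B : set T2)
    (f : T1 * T2 -> \bar R) x y :
  (f \_ (A `*` B)) (x, y) =
  ((fun x => ((fun y => f (x, y)) \_ B) y) \_ A) x.
Proof.
rewrite /patch; case: ifPn; last case: ifPn => //.
  by rewrite inE => -[/= xA yB]; rewrite !mem_set.
rewrite inE => xA; case: ifPn => //; rewrite inE => yB /negP; rewrite inE.
by case.
Qed.

Lemma integral_setX12 d1 d2 (T1 : measurableType d1) (T2 : measurableType d2)
    (R : realType) (m1 : {sigma_finite_measure set T1 -> \bar R})
    (m2 : {sigma_finite_measure set T2 -> \bar R}) (A : set T1) (B : set T2)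
    (f : T1 * T2 -> \bar R) :
  measurable A -> measurable B -> (m1 \x m2)%E.-integrable (A `*` B) f ->
  (\int[m1 \x m2]_(z in A `*` B) f z =
   \int[m1]_(x in A) \int[m2]_(y in B) f (x, y))%E.
Proof.
move=> mA mB fi; rewrite integral_mkcond -integral12_prod_meas1; last first.
  by rewrite -integrable_mkcond //; exact: measurableX.
rewrite [RHS]integral_mkcond; apply: eq_integral => x _.
rewrite /fubini_F /patch; case: ifPn => xA.
  rewrite [RHS]integral_mkcond; apply: eq_integral => y _.
  by have := restrict_pair A B f x y; rewrite /patch xA.
rewrite integral0_eq // => y _.
by have := restrict_pair A B f x y; rewrite /patch (negbTE xA).
Qed.

Lemma integral_setX21 d1 d2 (T1 : measurableType d1) (T2 : measurableType d2)
    (R : realType) (m1 : {sigma_finite_measure set T1 -> \bar R})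
    (m2 : {sigma_finite_measure set T2 -> \bar R}) (A : set T1) (B : set T2)
    (f : T1 * T2 -> \bar R) :
  measurable A -> measurable B -> (m1 \x m2)%E.-integrable (A `*` B) f ->
  (\int[m1 \x m2]_(z in A `*` B) f z =
   \int[m2]_(y in B) \int[m1]_(x in A) f (x, y))%E.
Proof.
move=> mA mB fi; rewrite integral_mkcond -integral21_prod_meas1; last first.
  by rewrite -integrable_mkcond //; exact: measurableX.
rewrite [RHS]integral_mkcond; apply: eq_integral => y _.
rewrite /fubini_G /patch; case: ifPn => yB.
  rewrite [RHS]integral_mkcond; apply: eq_integral => x _.
  by have := restrict_pair A B f x y; rewrite /patch yB.
rewrite integral0_eq // => x _.
by have := restrict_pair A B f x y; rewrite /patch (negbTE yB) if_same.
Qed.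

Lemma is_derive_continuous (R : realType) (F : R -> R) (x d : R) :
  is_derive x 1 F d -> {for x, continuous F}.
Proof.
by move=> [Fd _]; apply: differentiable_continuous; exact/derivable1_diffP.
Qed.

Lemma ftc_segment (R : realType) (F f : R -> R) (a b : R) : a < b ->
  continuous f -> (forall x : R, is_derive x 1 F (f x)) ->
  (\int[lebesgue_measure]_(x in `[a, b]) (f x)%:E = (F b - F a)%:E)%E.
Proof.
move=> ab cf dF; rewrite EFinB; apply: continuous_FTC2 => //.
- exact: continuous_subspaceT.
- split => [x _||]; first by have [] := dF x.
    by apply: cvg_at_right_filter; exact: is_derive_continuous (dF a).
  by apply: cvg_at_left_filter; exact: is_derive_continuous (dF b).
- by move=> x _; rewrite derive1E; have [_ ->] := dF x.
Qed.

Lemma EFin_Rintegral_cell (R : realType) (f : R * R -> R) : continuous f ->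
  (\int[leb2 R]_(z in cell R) (f z)%:E =
   (\int[leb2 R]_(z in cell R) f z)%:E)%E.
Proof.
move=> cf; rewrite /Rintegral fineK //.
apply: integrable_fin_num; first exact: measurable_cell.
exact: continuous_integrable_cell.
Qed.

Lemma integral_cell_dx (R : realType) (F f : R * R -> R) :
  continuous f -> xperiodic F ->
  (forall x y : R, is_derive x 1 (fun x => F (x, y)) (f (x, y))) ->
  \int[leb2 R]_(z in cell R) f z = 0.
Proof.
move=> cf pF dF; rewrite /Rintegral.
rewrite [X in fine X](_ : _ = 0%E) //.
rewrite integral_setX21 //; last exact: continuous_integrable_cell.
apply: integral0_eq => y _ /=.
rewrite integral_itv_bndo_bndc.
  rewrite (@ftc_segment R (fun x => F (x, y))) ?pi_gt0 ?mulr_gt0 ?pi_gt0 //.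
    by have := pF 0 y; rewrite add0r => ->; rewrite subrr.
  exact: continuous_slice1.
apply/measurable_EFinP; apply: measurable_funTS.
apply: measurable_realfun.continuous_measurable_fun; exact: continuous_slice1.
Qed.

Lemma integral_cell_dy (R : realType) (F f : R * R -> R) :
  continuous f -> (forall x, F (x, 1) = F (x, -1)) ->
  (forall x y : R, is_derive y 1 (fun y => F (x, y)) (f (x, y))) ->
  \int[leb2 R]_(z in cell R) f z = 0.
Proof.
move=> cf pF dF; rewrite /Rintegral.
rewrite [X in fine X](_ : _ = 0%E) //.
rewrite integral_setX12 //; last exact: continuous_integrable_cell.
apply: integral0_eq => x _ /=.
rewrite (@ftc_segment R (fun y => F (x, y))) ?gtrN //.
  by rewrite pF subrr.
exact: continuous_slice2.
Qed.

(** Fubini's theorem over space and time needs [leb2] as a sigma-finite measure,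
    which is registered below. *)
Lemma sigma_finite_product d1 d2 (T1 : measurableType d1)
    (T2 : measurableType d2) (R : realType)
    (m1 : {sigma_finite_measure set T1 -> \bar R})
    (m2 : {sigma_finite_measure set T2 -> \bar R}) :
  sigma_finite setT (m1 \x m2)%E.
Proof.
have /sigma_finiteP[F [TF ndF Foo]] := sigma_finiteT m1.
have /sigma_finiteP[G [TG ndG Goo]] := sigma_finiteT m2.
exists (fun n => F n `*` G n) => [|n].
  rewrite -setXTT TF TG; apply/seteqP; split=> [[x y] /= [[n _ Fx] [k _ Gy]]|].
    exists (maxn n k) => //; split => /=.
      by have /subsetPset := ndF _ _ (leq_maxl n k); exact.
    by have /subsetPset := ndG _ _ (leq_maxr n k); exact.
  by move=> [x y] [n _ [/= Fx Gy]]; split; exists n.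
have [mF Fn] := Foo n; have [mG Gn] := Goo n.
split; first exact: measurableX.
by rewrite product_measure1E // lte_mul_pinfty // ge0_fin_numE.
Qed.

HB.instance Definition _ (R : realType) := Measure.copy (leb2 R)
  (@lebesgue_measure R \x @lebesgue_measure R)%E.

HB.instance Definition _ (R : realType) :=
  Measure_isSigmaFinite.Build _ _ _ (leb2 R)
    (sigma_finite_product (@lebesgue_measure R) (@lebesgue_measure R)).

Lemma continuous_integrable_cell_time (R : realType) (T : R) (f : R * R * R -> R) :
  continuous f ->
  ((leb2 R \x lebesgue_measure)%E).-integrable (cell R `*` `[0, T])
    (EFin \o f).
Proof.
move=> cf.
have mD : measurable (cell R `*` `[0, T]).
  by apply: measurableX; [exact: measurable_cell | exact: measurable_itv].
apply: measurable_bounded_integrable => //.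
- have H : ((leb2 R \x lebesgue_measure)%E (cell R `*` `[0%R, T]) < +oo)%E.
    rewrite product_measure1E //=; last exact: measurable_cell.
    rewrite [X in (X * _)%E](_ : _ = (4 * pi)%:E); last exact: leb2_cell.
    rewrite lebesgue_measure_itv /=; case: ifP => _; last by rewrite mule0.
    by rewrite -EFinB -EFinM ltry.
  exact: H.
- apply: measurable_funTS; apply: caratheodory_measurable => [t|z].
    by apply: continuous_measurable2; exact: continuous_slice1.
  exact: continuous_slice2.
- have [|M M0 HM] := @compact_bound R _ f ((`[0, 2 * pi] `*` `[-1, 1]) `*` `[0, T]) cf.
    by apply: compact_setX; [apply: compact_setX|]; exact: segment_compact.
  exists M; split; first exact: num_real.
  move=> x Mx [z t] /= [[/= z1 z2] tT] /=; rewrite (le_trans _ (ltW Mx)) //.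
  apply: HM; split => //=; split => //=.
  by move: z1; rewrite !in_itv /= => /andP[-> /ltW].
Qed.

Lemma integral_time_dt (R : realType) (T : R) (F f : R * R * R -> R) : 0 < T ->
  continuous f -> (forall z, F (z, 0) = F (z, T)) ->
  (forall z (t : R), is_derive t 1 (fun t => F (z, t)) (f (z, t))) ->
  \int[lebesgue_measure]_(t in `[0, T]) \int[leb2 R]_(z in cell R) f (z, t) = 0.
Proof.
move=> T0 cf F0 dF; rewrite /Rintegral.
rewrite [X in fine X](_ : _ =
  \int[lebesgue_measure]_(t in `[0%R, T]) \int[leb2 R]_(z in cell R) (f (z, t))%:E)%E; last first.
  apply: eq_integral => t _; rewrite EFin_Rintegral_cell //.
  exact: continuous_slice1.
have fi := continuous_integrable_cell_time T cf.
have -> := esym (@integral_setX21 _ _ _ _ R (leb2 R) (@lebesgue_measure R) (cell R)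
  `[0, T] (EFin \o f) (@measurable_cell R) (measurable_itv _) fi).
have -> := @integral_setX12 _ _ _ _ R (leb2 R) (@lebesgue_measure R) (cell R)
  `[0, T] (EFin \o f) (@measurable_cell R) (measurable_itv _) fi.
rewrite integral0_eq // => z _.
rewrite (@ftc_segment R (fun t => F (z, t))) ?F0 ?subrr //.
exact: continuous_slice2.
Qed.

(** * Functions of class C1 on the plane *)

(** A directional derivative only depends on the values along one line.  All the
    changes of variables used below (slices, translations, passage to the moving
    frame) are affine, hence instances of this remark. *)
Lemma is_derive_along (R : realType) (V W : normedModType R) (f : V -> R)
    (F : W -> R) (z v : V) (a w : W) (d : R) :
  (forall h : R, F (h *: w + a) = f (h *: v + z)) ->
  is_derive z v f d -> is_derive a w F d.
Proof.
move=> Ff [fd <-].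
have F0 : F a = f z by have := Ff 0; rewrite !scale0r !add0r.
have E : (fun h : R => h^-1 *: ((F \o shift a) (h *: w) - F a)) =
         (fun h : R => h^-1 *: ((f \o shift z) (h *: v) - f z)).
  by apply/funext => h /=; rewrite F0 Ff.
by split; rewrite /derivable /derive E.
Qed.

(** Derivatives in all directions are what [Ck_on] is made of, and each of them
    is a one-variable derivative; this is why the gradient is encoded by them
    and not by a Frechet differential. *)
Definition C1 (R : realType) (f fx fy : R * R -> R) : Prop :=
  [/\ continuous f, continuous fx, continuous fy &
      forall z v, is_derive z v f (v.1 * fx z + v.2 * fy z)].

Lemma C1_ext (R : realType) (f fx fy g gx gy : R * R -> R) :
  C1 f fx fy -> f =1 g -> fx =1 gx -> fy =1 gy -> C1 g gx gy.
Proof. by move=> H /funext <- /funext <- /funext <-. Qed.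

Lemma C1_cst (R : realType) (k : R) : C1 (fun=> k) (fun=> 0) (fun=> 0).
Proof.
split => [z|z|z|z v]; try exact: cvg_cst.
by apply: is_derive_eq; rewrite !mulr0 addr0.
Qed.

Lemma continuous_mul (R : realType) (T : topologicalType) (f g : T -> R) :
  continuous f -> continuous g -> continuous (fun z => f z * g z).
Proof. by move=> cf cg z; apply: cvgM; [exact: cf | exact: cg]. Qed.

Lemma continuous_add (R : realType) (T : topologicalType) (f g : T -> R) :
  continuous f -> continuous g -> continuous (fun z => f z + g z).
Proof. by move=> cf cg z; apply: cvgD; [exact: cf | exact: cg]. Qed.

Lemma C1_add (R : realType) (f fx fy g gx gy : R * R -> R) :
  C1 f fx fy -> C1 g gx gy ->
  C1 (fun z => f z + g z) (fun z => fx z + gx z) (fun z => fy z + gy z).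
Proof.
move=> [c1 c2 c3 df] [e1 e2 e3 dg].
split=> [|||z v]; try exact: continuous_add.
have Df := df z v; have Dg := dg z v.
by apply: (is_derive_eq (is_deriveD Df Dg)); ring.
Qed.

Lemma C1_mul (R : realType) (f fx fy g gx gy : R * R -> R) :
  C1 f fx fy -> C1 g gx gy ->
  C1 (fun z => f z * g z) (fun z => fx z * g z + f z * gx z)
     (fun z => fy z * g z + f z * gy z).
Proof.
move=> [c1 c2 c3 df] [e1 e2 e3 dg].
split=> [|||z v]; [|apply: continuous_add|apply: continuous_add|];
  try exact: continuous_mul.
have Df := df z v; have Dg := dg z v.
by apply: (is_derive_eq (is_deriveM Df Dg)); rewrite /GRing.scale /=; ring.
Qed.

Lemma C1_scale (R : realType) (k : R) (f fx fy : R * R -> R) :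
  C1 f fx fy -> C1 (fun z => k * f z) (fun z => k * fx z) (fun z => k * fy z).
Proof.
move=> Hf; apply: (C1_ext (C1_mul (C1_cst k) Hf)) => z //=; by rewrite mul0r add0r.
Qed.

Lemma C1_fst (R : realType) : @C1 R fst (fun=> 1) (fun=> 0).
Proof.
split=> [z|z|z|z v]; [exact: continuous_fst|exact: cvg_cst|exact: cvg_cst|].
apply: (@is_derive_along _ _ _ id _ z.1 v.1) => //.
by apply: is_derive_eq; rewrite mulr1 mulr0 addr0.
Qed.

Lemma C1_snd (R : realType) : @C1 R snd (fun=> 0) (fun=> 1).
Proof.
split=> [z|z|z|z v]; [exact: continuous_snd|exact: cvg_cst|exact: cvg_cst|].
apply: (@is_derive_along _ _ _ id _ z.2 v.2) => //.
by apply: is_derive_eq; rewrite mulr1 mulr0 add0r.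
Qed.

Lemma C1_comp (R : realType) (G g : R -> R) (f fx fy : R * R -> R) :
  continuous g -> (forall t : R, is_derive t 1 G (g t)) -> C1 f fx fy ->
  C1 (fun z => G (f z)) (fun z => g (f z) * fx z) (fun z => g (f z) * fy z).
Proof.
move=> cg dG [c1 c2 c3 df].
have cG : continuous G by move=> t; exact: is_derive_continuous (dG t).
have cgf : continuous (fun z => g (f z)) by exact: continuous_compf.
split=> [|z|z|z v]; first exact: continuous_compf.
- by apply: cvgM; [exact: cgf | exact: c2].
- by apply: cvgM; [exact: cgf | exact: c3].
pose l (h : R) := f (h *: v + z).
have dl : is_derive (0 : R) 1 l (v.1 * fx z + v.2 * fy z).
  apply: (is_derive_along _ (df z v)) => h.
  by rewrite /l addr0 [h *: 1]mulr1.
have dG0 : is_derive (l 0) 1 G (g (f z)) by rewrite /l scale0r add0r; exact: dG.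
have dGl := is_derive1_comp dG0 dl.
rewrite (_ : _ + _ = g (f z) * (v.1 * fx z + v.2 * fy z)); last by ring.
apply: (is_derive_along _ dGl) => h.
by rewrite /= /l addr0 [h *: 1]mulr1.
Qed.

Lemma C1_translate (R : realType) (c : R) (f fx fy : R * R -> R) : C1 f fx fy ->
  C1 (fun z => f (z.1 + c, z.2)) (fun z => fx (z.1 + c, z.2))
     (fun z => fy (z.1 + c, z.2)).
Proof.
move=> [c1 c2 c3 df].
have cT : continuous (fun z : R * R => (z.1 + c, z.2)).
  apply: continuous_pairing; last exact: continuous_snd.
  by move=> z; apply: cvgD; [exact: continuous_fst | exact: cvg_cst].
split=> [|||z v]; try exact: continuous_compf.
apply: (is_derive_along _ (df (z.1 + c, z.2) v)) => h.
by congr f; apply/pair_equal_spec; split => //=; rewrite addrA.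
Qed.

Lemma C1_dx (R : realType) (f fx fy : R * R -> R) (x y : R) : C1 f fx fy ->
  is_derive x 1 (fun x => f (x, y)) (fx (x, y)).
Proof.
move=> [_ _ _ df].
have := df (x, y) (1, 0); rewrite /= mul1r mul0r ?addr0 ?add0r => D.
apply: (is_derive_along _ D) => h.
by congr f; apply/pair_equal_spec; split => //=; rewrite /GRing.scale /= mulr0 add0r.
Qed.

Lemma C1_dy (R : realType) (f fx fy : R * R -> R) (x y : R) : C1 f fx fy ->
  is_derive y 1 (fun y => f (x, y)) (fy (x, y)).
Proof.
move=> [_ _ _ df].
have := df (x, y) (0, 1); rewrite /= mul1r mul0r ?addr0 ?add0r => D.
apply: (is_derive_along _ D) => h.
by congr f; apply/pair_equal_spec; split => //=; rewrite /GRing.scale /= mulr0 add0r.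
Qed.

Lemma C1_derive (R : realType) (f fx fy : R * R -> R) (v : R * R) :
  C1 f fx fy -> 'D_v f = (fun z => v.1 * fx z + v.2 * fy z).
Proof. by move=> [_ _ _ df]; apply/funext => z; have [_ ->] := df z v. Qed.

(** * Stream functions and steady profiles *)

Lemma is_derive_unique (R : realType) (V W : normedModType R) (f : V -> W)
    (z v : V) (d e : W) : is_derive z v f d -> is_derive z v f e -> d = e.
Proof. by move=> [_ <-] [_ <-]. Qed.

Lemma C1_xperiodic (R : realType) (f fx fy : R * R -> R) :
  C1 f fx fy -> xperiodic f -> xperiodic fx /\ xperiodic fy.
Proof.
move=> Hf pf; split=> x y.
  apply: (is_derive_unique _ (C1_dx x y Hf)).
  apply: (is_derive_along _ (C1_dx (x + 2 * pi) y Hf)) => h.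
  by rewrite -pf addrA.
apply: (is_derive_unique _ (C1_dy x y Hf)).
by apply: (is_derive_along _ (C1_dy (x + 2 * pi) y Hf)) => h; rewrite pf.
Qed.

Lemma derivable_dx (R : realType) (eta : R * R -> R) (x y : R) :
  derivable eta (x, y) (dirx R) ->
  is_derive x 1 (fun x => eta (x, y)) ('D_(dirx R) eta (x, y)).
Proof.
move=> /derivableP D; apply: (is_derive_along _ D) => h.
by congr eta; apply/pair_equal_spec; split => //=; rewrite /GRing.scale /= mulr0 add0r.
Qed.

Lemma derivable_dy (R : realType) (eta : R * R -> R) (x y : R) :
  derivable eta (x, y) (diry R) ->
  is_derive y 1 (fun y => eta (x, y)) ('D_(diry R) eta (x, y)).
Proof.
move=> /derivableP D; apply: (is_derive_along _ D) => h.
by congr eta; apply/pair_equal_spec; split => //=; rewrite /GRing.scale /= mulr0 add0r.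
Qed.

Lemma smooth_continuous (R : realType) (V : normedModType R) (f : V -> R) :
  smooth f -> continuous f.
Proof. by move=> /(_ 0%N) [cf _] z; exact: cf. Qed.

Lemma smooth_derive (R : realType) (V : normedModType R) (f : V -> R) (v : V) :
  smooth f -> (forall z, derivable f z v) /\ continuous ('D_v f).
Proof.
move=> /(_ 1%N) [_ /(_ v) [df [cf _]]].
by split => z; [exact: df | exact: cf].
Qed.

Lemma Rintegral_cellD (R : realType) (f g : R * R -> R) :
  continuous f -> continuous g ->
  \int[leb2 R]_(z in cell R) (f z + g z) =
  \int[leb2 R]_(z in cell R) f z + \int[leb2 R]_(z in cell R) g z.
Proof.
move=> cf cg; apply: RintegralD; first exact: measurable_cell.
  exact: continuous_integrable_cell.
exact: continuous_integrable_cell.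
Qed.

(** The x-integral of the derivative of [f * eta] vanishes by periodicity, the
    y-integral because [eta] vanishes near the walls. *)
Lemma weak_partial_C1 (R : realType) (f fx fy : R * R -> R) :
  C1 f fx fy -> xperiodic f ->
  weak_partial (dirx R) f fx /\ weak_partial (diry R) f fy.
Proof.
move=> Hf pf; have [c1 c2 c3 df] := Hf.
split; split; try exact: continuous_integrable_cell.
- move=> eta [se pe _]; have ce := smooth_continuous se.
  have [de cde] := smooth_derive (dirx R) se.
  apply/eqP; rewrite -subr_eq0 opprK -Rintegral_cellD; try exact: continuous_mul.
  apply/eqP; apply: (@integral_cell_dx _ (fun z => f z * eta z)).
  + by apply: continuous_add; exact: continuous_mul.
  + by move=> x y /=; rewrite pf pe.
  + move=> x y; apply: (is_derive_eq (is_deriveM (C1_dx x y Hf) (derivable_dx (de (x, y))))).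
    by rewrite /GRing.scale /=; ring.
- move=> eta [se _ [d d0 He]]; have ce := smooth_continuous se.
  have [de cde] := smooth_derive (diry R) se.
  have eta0 x y : y = 1 \/ y = -1 -> eta (x, y) = 0.
    move=> H; apply/eqP; apply: contraT => /He.
    by case: H => -> /andP[]; lra.
  apply/eqP; rewrite -subr_eq0 opprK -Rintegral_cellD; try exact: continuous_mul.
  apply/eqP; apply: (@integral_cell_dy _ (fun z => f z * eta z)).
  + by apply: continuous_add; exact: continuous_mul.
  + by move=> x /=; rewrite !eta0 ?mulr0; [|right|left].
  + move=> x y; apply: (is_derive_eq (is_deriveM (C1_dy x y Hf) (derivable_dy (de (x, y))))).
    by rewrite /GRing.scale /=; ring.
Qed.

Lemma ess_bounded_continuous (R : realType) (f : R * R -> R) :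
  continuous f -> ess_bounded f.
Proof.
move=> cf; split; first by apply: measurable_funTS; exact: continuous_measurable2.
by have [M _ HM] := cell_bound cf; exists M; exact: aeW.
Qed.

Lemma W1infty_C1 (R : realType) (f fx fy : R * R -> R) :
  C1 f fx fy -> xperiodic f -> W1infty f.
Proof.
move=> Hf pf; have [c1 c2 c3 _] := Hf; have [w1 w2] := weak_partial_C1 Hf pf.
split=> //; first exact: ess_bounded_continuous.
by exists fx, fy; split=> //; exact: ess_bounded_continuous.
Qed.

Lemma stream_velocity (R : realType) (Psi Px Py Pxx Pxy Pyy : R * R -> R) :
  C1 Psi Px Py -> C1 Px Pxx Pxy -> C1 Py Pxy Pyy -> xperiodic Psi ->
  (forall x, Psi (x, 1) = - (1 / 3) /\ Psi (x, -1) = 1 / 3) ->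
  velocity_of (fun z => Pxx z + Pyy z) (fun z => (- Py z, Px z)).
Proof.
move=> HP Hx Hy pP bP; have [pPx pPy] := C1_xperiodic HP pP.
have [cP cPx cPy _] := HP; have [_ cxx cxy _] := Hx; have [_ _ cyy _] := Hy.
have P0 x y : (forall x', Psi (x', y) = Psi (x, y)) -> Px (x, y) = 0.
  move=> H; apply: (is_derive_unique (C1_dx x y HP)).
  by rewrite (_ : (fun _ => _) = cst (Psi (x, y)));
    [exact: is_derive_cst|apply/funext => x'; exact: H].
split.
- by move=> x y; rewrite pPx pPy.
- apply: continuous_subspaceT; apply: continuous_pairing => // z.
  by apply: cvgN; exact: cPy.
- move=> x; split => /=; apply: P0 => x'.
    by have [-> _] := bP x'; have [-> _] := bP x.
  by have [_ ->] := bP x'; have [_ ->] := bP x.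
- move=> x; rewrite /Rintegral /=.
  have D (y : R) : is_derive y 1 (fun y => - Psi (x, y)) (- Py (x, y)).
    by have Dy := C1_dy x y HP; exact: is_deriveN.
  have cN : continuous (fun y => - Py (x, y)).
    apply: (@continuous_slice2 _ _ _ (fun z => - Py z)) => z.
    by apply: cvgN; exact: cPy.
  have -> := ftc_segment (ltac:(lra) : -1 < 1) cN D.
  by have [-> ->] := bP x => /=; lra.
exists Psi; split => //; first exact: continuous_subspaceT.
- split; first by move=> z _; exact: cP.
  move=> v; split; first by move=> z _; have [_ _ _ /(_ z v) []] := HP.
  rewrite (C1_derive v HP).
  have Hv := C1_add (C1_scale v.1 Hx) (C1_scale v.2 Hy).
  have [cv _ _ dv] := Hv.
  split; first by move=> z _; exact: cv.
  move=> w; split; first by move=> z _; have [] := dv z w.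
  split=> // z _; rewrite (C1_derive w Hv); have [_ c1 c2 _] := Hv.
  by apply: continuous_add; apply: continuous_mul => // p; exact: cvg_cst.
- pose Dx (f : R * R -> R) : R * R -> R := 'D_(dirx R) f.
  pose Dy (f : R * R -> R) : R * R -> R := 'D_(diry R) f.
  have D1 f fx fy : C1 f fx fy -> Dx f = fx.
    by move=> /C1_derive; rewrite /Dx => ->; apply/funext => p /=; rewrite mul1r mul0r addr0.
  have D2 f fx fy : C1 f fx fy -> Dy f = fy.
    by move=> /C1_derive; rewrite /Dy => ->; apply/funext => p /=; rewrite mul1r mul0r add0r.
  move=> z _; change ((- Py z, Px z) = (- Dy Psi z, Dx Psi z) /\
    Dx (Dx Psi) z + Dy (Dy Psi) z = Pxx z + Pyy z).
  by rewrite (D1 _ _ _ HP) (D2 _ _ _ HP) (D1 _ _ _ Hx) (D2 _ _ _ Hy).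
Qed.

Lemma derivable_slice (R : realType) (eta : R * R * R -> R) (x y t : R)
    (v : R * R * R) (F : R -> R) (a : R) :
  derivable eta (x, y, t) v ->
  (forall h : R, F (h + a) = eta (x + h * v.1.1, y + h * v.1.2, t + h * v.2)) ->
  is_derive a 1 F ('D_v eta (x, y, t)).
Proof.
move=> /derivableP D HF; apply: (is_derive_along _ D) => h.
rewrite [h *: 1]mulr1 HF; congr eta.
by apply/pair_equal_spec; split; [apply/pair_equal_spec; split|]; rewrite addrC.
Qed.

(** The hypothesis on [lam] says that the profile is transported by the velocity
    [(- Py, Px)] seen in the moving frame.  Since this velocity is divergence
    free, the integrand of the weak formulation is the space-time divergence of
    [eta * w * (1, u)], and each of its three terms integrates to zero: the time
    term after exchanging the order of integration. *)
Lemma traveling_wave (R : realType) (lam : R)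
    (Psi Px Py Pxx Pxy Pyy wx wy : R * R -> R) :
  C1 Psi Px Py -> C1 Px Pxx Pxy -> C1 Py Pxy Pyy ->
  C1 (fun z => Pxx z + Pyy z) wx wy -> xperiodic Psi ->
  (forall x, Psi (x, 1) = - (1 / 3) /\ Psi (x, -1) = 1 / 3) ->
  (forall z, (lam - Py z) * wx z + Px z * wy z = 0) ->
  euler_weak_sol
    (fun t z => Pxx (z.1 + lam * t, z.2) + Pyy (z.1 + lam * t, z.2))
    (fun t z => (- Py (z.1 + lam * t, z.2), Px (z.1 + lam * t, z.2))).
Proof.
move=> HP Hx Hy Hw pP bP stat.
have [pPx pPy] := C1_xperiodic HP pP.
have [pxx pxy] := C1_xperiodic Hx pPx.
have [_ pyy] := C1_xperiodic Hy pPy.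
have shift_per (f : R * R -> R) c : xperiodic f -> xperiodic (fun z => f (z.1 + c, z.2)).
  by move=> pf x y /=; rewrite addrAC pf.
split.
- move=> t _; apply: (W1infty_C1 (C1_translate (lam * t) Hw)).
  by apply: (@shift_per (fun z => Pxx z + Pyy z)) => x y; rewrite pxx pyy.
- move=> t _.
  apply: (stream_velocity (C1_translate (lam * t) HP) (C1_translate (lam * t) Hx)
    (C1_translate (lam * t) Hy)); first exact: shift_per.
  by move=> x /=; exact: bP.
move=> T eta T0 [se pe [d d0 He]].
set w := fun z => Pxx z + Pyy z.
have [cw cwx cwy _] := Hw; have [cP cPx cPy _] := HP.
have [_ cxx cxy _] := Hx; have [_ _ cyy _] := Hy.
have ceta := smooth_continuous se.
have [d1 cd1] := smooth_derive ((1, 0, 0) : R * R * R) se.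
have [d2 cd2] := smooth_derive ((0, 1, 0) : R * R * R) se.
have [d3 cd3] := smooth_derive ((0, 0, 1) : R * R * R) se.
pose m (q : R * R * R) : R * R := (q.1.1 + lam * q.2, q.1.2).
have cm : continuous m.
  apply: continuous_pairing.
    apply: continuous_add; first by apply: continuous_compf; exact: continuous_fst.
    by apply: continuous_mul; [move=> q; exact: cvg_cst | exact: continuous_snd].
  by apply: (@continuous_compf _ _ _ fst snd);
     [exact: continuous_fst | exact: continuous_snd].
have cc (f : R * R -> R) : continuous f -> continuous (fun q => f (m q)).
  by move=> cf; exact: continuous_compf.
(* [At], [Bx], [Cy] are the t-, x- and y-derivatives of the three components
   of [eta * w * (1, u)], with [u = (- Py, Px)] *)
pose At q := lam * wx (m q) * eta q + w (m q) * 'D_(0, 0, 1) eta q.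
pose Bx q := - (wx (m q) * Py (m q) + w (m q) * Pxy (m q)) * eta q
             - w (m q) * Py (m q) * 'D_(1, 0, 0) eta q.
pose Cy q := (wy (m q) * Px (m q) + w (m q) * Pxy (m q)) * eta q
             + w (m q) * Px (m q) * 'D_(0, 1, 0) eta q.
have cN (f : R * R * R -> R) : continuous f -> continuous (fun q => - f q).
  by move=> cf q; apply: cvgN; exact: cf.
have [mw mwx mwy] := And3 (cc _ cw) (cc _ cwx) (cc _ cwy).
have [mPx mPy mPxy] := And3 (cc _ cPx) (cc _ cPy) (cc _ cxy).
have clam : continuous (fun _ : R * R * R => lam) by move=> q; exact: cvg_cst.
have cA : continuous At.
  exact: (continuous_add (continuous_mul (continuous_mul clam mwx) ceta)
                         (continuous_mul mw cd3)).
have cB : continuous Bx.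
  exact: (continuous_add (continuous_mul
      (cN _ (continuous_add (continuous_mul mwx mPy) (continuous_mul mw mPxy))) ceta)
    (cN _ (continuous_mul (continuous_mul mw mPy) cd1))).
have cC : continuous Cy.
  exact: (continuous_add (continuous_mul
      (continuous_add (continuous_mul mwy mPx) (continuous_mul mw mPxy)) ceta)
    (continuous_mul (continuous_mul mw mPx) cd2)).
have slice (f : R * R * R -> R) t : continuous f -> continuous (fun z => f (z, t)).
  exact: continuous_slice1.
have IA : \int[lebesgue_measure]_(t in `[0, T])
            \int[leb2 R]_(z in cell R) At (z, t) = 0.
  apply: (@integral_time_dt R T (fun q => w (m q) * eta q)) => //.
  - move=> [x y]; have eta0 t : ~~ (d <= t <= T - d) -> eta (x, y, t) = 0.
      move=> H; apply/eqP; apply: contraT => /He [_].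
      by rewrite (negbTE H).
    rewrite !eta0 ?mulr0 //.
      by apply/negP => /andP[]; lra.
    by apply/negP => /andP[]; lra.
  - move=> [x y] t.
    have D : is_derive t 1 (fun t => w (m (x, y, t))) (lam * wx (m (x, y, t))).
      have [_ _ _ /(_ (m (x, y, t)) (lam, 0))] := Hw.
      rewrite /= mul0r addr0 => D; apply: (is_derive_along _ D) => h.
      rewrite -[RHS]/(w (_ + _)); congr w.
      by apply/pair_equal_spec; split; rewrite /m /= /GRing.scale /=; ring.
    have E : is_derive t 1 (fun t => eta (x, y, t)) ('D_(0, 0, 1) eta (x, y, t)).
      by apply: derivable_slice => // h /=; rewrite !mulr0 !addr0 mulr1 addrC.
    by apply: (is_derive_eq (is_deriveM D E)); rewrite /At /GRing.scale /=; ring.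
rewrite -[RHS]IA; congr Rintegral; apply/funext => t.
rewrite (_ : (fun z => _) = (fun z => At (z, t) + (Bx (z, t) + Cy (z, t)))); last first.
  apply/funext => -[x y]; rewrite /At /Bx /Cy /m /=.
  have := stat (x + lam * t, y); rewrite -/(w _).
  move: (wx _) (wy _) (Px _) (Py _) (Pxy _) (w _) (eta _) ('D_(0, 0, 1) eta _)
    ('D_(1, 0, 0) eta _) ('D_(0, 1, 0) eta _) => a b p q pq v e et ex ey st.
  apply/eqP; rewrite -subr_eq0 -[X in _ == X](mul0r (- e)) -st.
  by apply/eqP; ring.
rewrite (@Rintegral_cellD _ (fun z => At (z, t))
  (fun z => Bx (z, t) + Cy (z, t))); [|exact: slice|
  by apply: continuous_add; exact: slice].
rewrite (@Rintegral_cellD _ (fun z => Bx (z, t))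
  (fun z => Cy (z, t))); [|exact: slice|exact: slice].
suff [-> ->] : \int[leb2 R]_(z in cell R) Bx (z, t) = 0 /\
               \int[leb2 R]_(z in cell R) Cy (z, t) = 0 by rewrite !addr0.
split.
  apply: (@integral_cell_dx R (fun z => - (w (m (z, t)) * Py (m (z, t))) * eta (z, t))).
  - exact: slice.
  - move=> x y; rewrite /m /= pe /w addrAC.
    by rewrite pxx pyy pPy.
  - move=> x y.
    have D f fx fy : C1 f fx fy -> is_derive x 1 (fun x => f (m (x, y, t))) (fx (m (x, y, t))).
      move=> Hf; apply: (is_derive_along _ (C1_dx (x + lam * t) y Hf)) => h.
      by rewrite /m /= addrA.
    have E : is_derive x 1 (fun x => eta (x, y, t)) ('D_(1, 0, 0) eta (x, y, t)).
      by apply: derivable_slice => // h /=; rewrite !mulr0 !addr0 mulr1 addrC.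
    apply: (is_derive_eq (is_deriveM (is_deriveN (is_deriveM (D _ _ _ Hw) (D _ _ _ Hy))) E)).
    by rewrite /Bx /w !fctE /GRing.scale /=; ring.
apply: (@integral_cell_dy R (fun z => (w (m (z, t)) * Px (m (z, t))) * eta (z, t))).
- exact: slice.
- move=> x; have eta0 y : y = 1 \/ y = -1 -> eta (x, y, t) = 0.
    move=> H; apply/eqP; apply: contraT => /He [+ _].
    by case: H => -> /andP[]; lra.
  by rewrite !eta0 ?mulr0; [|right|left].
- move=> x y.
  have D f fx fy : C1 f fx fy -> is_derive y 1 (fun y => f (m (x, y, t))) (fy (m (x, y, t))).
    by move=> Hf; exact: (C1_dy (x + lam * t) y Hf).
  have E : is_derive y 1 (fun y => eta (x, y, t)) ('D_(0, 1, 0) eta (x, y, t)).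
    by apply: derivable_slice => // h /=; rewrite !mulr0 !addr0 mulr1 addrC.
  apply: (is_derive_eq (is_deriveM (is_deriveM (D _ _ _ Hw) (D _ _ _ Hx)) E)).
  by rewrite /Cy /w !fctE /GRing.scale /=; ring.
Qed.

(** * The fractional seminorm of a function concentrated in a strip *)

(** The integral of a nonnegative function is a supremum over the simple
    functions below it. *)
Lemma le_integral_ge0 d (T : measurableType d) (R : realType)
    (mu : {measure set T -> \bar R}) (D : set T) (f g : T -> \bar R) :
  (forall x, D x -> 0 <= f x)%E -> (forall x, D x -> f x <= g x)%E ->
  (\int[mu]_(x in D) f x <= \int[mu]_(x in D) g x)%E.
Proof.
move=> f0 fg; rewrite !ge0_integralE // => [|x Dx]; last first.
  by apply: le_trans (f0 x Dx) (fg x Dx).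
apply: le_ereal_sup => _ [h /= hf <-]; exists h => // x /=.
apply: le_trans (hf x) _; rewrite /patch; case: ifPn => // xD.
by apply: fg; rewrite inE in xD.
Qed.

Lemma integral_scaled_indic d (T : measurableType d) (R : realType)
    (mu : {measure set T -> \bar R}) (D A : set T) (k : R) :
  measurable D -> measurable A -> 0 <= k ->
  (\int[mu]_(x in D) (k * \1_A x)%:E = k%:E * mu (A `&` D))%E.
Proof.
move=> mD mA k0; rewrite (integralZl_indic mD (fun=> A)) ?integral_indic //.
by move=> /lt_geF; rewrite k0.
Qed.

Lemma term_le_nneseries (R : realType) (u : nat -> \bar R) (n : nat) :
  (forall k, 0 <= u k)%E -> (u n <= \sum_(0 <= k <oo) u k)%E.
Proof.
move=> u0; apply: le_trans (nneseries_lim_ge n.+1 _) => //.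
by rewrite big_nat_recr //= leeDr // sume_ge0.
Qed.

Lemma powR_exprn (R : realType) (x a : R) (n : nat) : 0 <= x ->
  (x ^+ n) `^ a = (x `^ a) ^+ n.
Proof.
by move=> x0; rewrite -powR_mulrn // -powRrM mulrC powRrM powR_mulrn ?powR_ge0.
Qed.

(** The singular kernel [d `^ (- (2 - a))] of the plane is dominated by a sum of
    multiples of indicators of the balls of radii [rho n = rho0 / 2 ^ n], so that
    integrating it amounts to measuring balls.  The resulting series is geometric
    of ratio [2 `^ (- a)]. *)
Lemma dyadic_kernel (R : realType) (rho0 a : R) : 0 < rho0 -> 0 < a < 2 ->
  exists (c rho : nat -> R) (K : R),
    [/\ forall n, 0 <= c n, forall n, 0 < rho n, 0 <= K,
        (\sum_(0 <= n <oo) (c n * rho n ^+ 2)%:E <= K%:E)%E &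
        forall d, 0 < d <= rho0 ->
          exists n, d <= rho n /\ d `^ (- (2 - a)) <= c n].
Proof.
move=> r0 /andP[a0 a2].
pose rho n : R := rho0 * (2^-1) ^+ n.
have rho_gt0 n : 0 < rho n by rewrite mulr_gt0 // exprn_gt0 // invr_gt0.
pose c n : R := rho n.+1 `^ (- (2 - a)).
pose q : R := (2^-1) `^ a.
have q1 : `|q| < 1.
  rewrite ger0_norm ?powR_ge0 // /q /powR gt_eqF ?invr_gt0 //.
  rewrite expR_lt1 pmulr_rlt0 // ln_lt0 //.
  by apply/andP; split; lra.
pose A : R := 4 * rho0 `^ a * q.
have cE n : c n * rho n ^+ 2 = geometric A q n.
  rewrite /c (_ : rho n = 2 * rho n.+1); last first.
    by rewrite /rho exprS; field.
  rewrite exprMn mulrCA -[X in _ * (_ * X)]powR_mulrn; last exact: ltW.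
  rewrite -powRD; last by apply/implyP => _; rewrite gt_eqF.
  rewrite (_ : - (2 - a) + 2%:R = a); last by rewrite mulr2n; ring.
  rewrite /rho powRM ?exprn_ge0 ?invr_ge0 //; last exact: ltW.
  by rewrite powR_exprn ?invr_ge0 // -/q /geometric /= /A [q ^+ n.+1]exprS; ring.
exists c, rho, (A / (1 - q)).
have q_ge0 : 0 <= q by exact: powR_ge0.
have A0 : 0 <= A by rewrite !mulr_ge0 // powR_ge0.
have q1' : q < 1 by move: q1; rewrite ger0_norm.
split=> [n||||d]; [exact: powR_ge0|exact: rho_gt0|..].
- by rewrite mulr_ge0 // invr_ge0 subr_ge0 ltW.
- have cvg : series (geometric A q) n @[n --> \oo] --> A / (1 - q).
    exact: cvg_geometric_series.
  rewrite (eq_eseriesr (g := fun n => (geometric A q n)%:E)); last first.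
    by move=> n _; rewrite cE.
  rewrite (_ : limn _ = (A / (1 - q))%:E) //.
  apply/cvg_lim => //; under eq_fun do rewrite sumEFin.
  by apply: cvg_EFin; [exact: nearW | exact: cvg].
move=> /andP[d0 dr].
have : exists n, rho n.+1 < d.
  have dr0 : 0 < d / rho0 by rewrite divr_gt0.
  have [N _ /(_ N (leqnn N)) HN] := near_infty_natSinv_expn_lt (PosNum dr0).
  exists N; apply: (@le_lt_trans _ _ (rho N)).
    rewrite /rho exprS mulrCA ler_piMl //; last by lra.
    by rewrite mulr_ge0 ?exprn_ge0 ?invr_ge0 ?ltW.
  by move: HN; rewrite /= ltr_pdivlMr // mul1r mulrC -exprVn.
move=> /ex_minnP[n Hn Hmin]; exists n; split.
  case: n Hn Hmin => [|n] Hn Hmin; first by rewrite /rho expr0 mulr1.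
  by rewrite leNgt; apply/negP => /Hmin; rewrite ltnn.
rewrite /c !powRN lef_pV2 ?posrE ?powR_gt0 //.
by rewrite ge0_ler_powR ?nnegrE ?subr_ge0 ?ltW.
Qed.

Lemma sqrt_sqrD_ge (R : realType) (a b : R) :
  `|a| <= Num.sqrt (a ^+ 2 + b ^+ 2) /\ `|b| <= Num.sqrt (a ^+ 2 + b ^+ 2).
Proof.
by split; rewrite -sqrtr_sqr ler_wsqrtr // ?lerDl ?lerDr sqr_ge0.
Qed.

Lemma sqrt_sqrD_le (R : realType) (a b : R) : 0 <= a -> 0 <= b ->
  Num.sqrt (a ^+ 2 + b ^+ 2) <= a + b.
Proof.
move=> a0 b0; rewrite -[leRHS]ger0_norm ?addr_ge0 // -sqrtr_sqr ler_wsqrtr //.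
by rewrite sqrrD lerD2r lerDl mulrn_wge0 // mulr_ge0.
Qed.

Lemma channel_dist_ge0 (R : realType) (z w : R * R) : 0 <= channel_dist z w.
Proof. exact: sqrtr_ge0. Qed.

Lemma channel_dist_le_diam (R : realType) (z w : R * R) :
  cell R z -> cell R w -> channel_dist z w <= 2 * pi + 2.
Proof.
move=> [/= z1 z2] [/= w1 w2]; rewrite /channel_dist.
move: z1 z2 w1 w2; rewrite !in_itv /= => /andP[a1 a2] /andP[b1 b2] /andP[c1 c2] /andP[d1 d2].
set a := `|z.1 - w.1|; set m := Num.min a _.
have a_le : a <= 2 * pi by rewrite /a ler_norml; apply/andP; split; lra.
have m0 : 0 <= m by rewrite /m le_min normr_ge0 subr_ge0.
rewrite -[(z.2 - w.2) ^+ 2]real_normK ?num_real //.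
apply: le_trans (sqrt_sqrD_le m0 (normr_ge0 _)) _.
apply: lerD; first by rewrite /m ge_min a_le.
by rewrite ler_norml; apply/andP; split; lra.
Qed.

(** The distance on the torus is attained after moving one point by at most one
    period. *)
Lemma channel_dist_shift (R : realType) (z w : R * R) :
  cell R z -> cell R w ->
  `|z.2 - w.2| <= channel_dist z w /\
  exists2 k : R, [\/ k = 0, k = 2 * pi | k = - (2 * pi)] &
    `|z.1 + k - w.1| <= channel_dist z w.
Proof.
move=> [/= z1 z2] [/= w1 w2]; move: z1 w1; rewrite !in_itv /=.
move=> /andP[a1 a2] /andP[c1 c2]; rewrite /channel_dist.
set a := `|z.1 - w.1|; set m := Num.min a _.
have [Hm H2] := sqrt_sqrD_ge m (z.2 - w.2); split=> //.
have {Hm} := le_trans (ler_norm _) Hm.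
move: (Num.sqrt _) => rho; rewrite /m ge_min /a => /orP[H|].
  by exists 0; [exact: Or31 | rewrite addr0].
have [zw|zw] := lerP w.1 z.1 => H.
  exists (- (2 * pi)); [exact: Or33 | ].
  by rewrite ler_norml; apply/andP; split; lra.
exists (2 * pi); [exact: Or32 | ].
by rewrite ler_norml; apply/andP; split; lra.
Qed.

(** The three translates account for the periodicity of the distance. *)
Definition xball (R : realType) (x0 rho : R) : set R :=
  `[x0 - rho, x0 + rho] `|` (`[x0 + 2 * pi - rho, x0 + 2 * pi + rho] `|`
    `[x0 - 2 * pi - rho, x0 - 2 * pi + rho]).

Lemma channel_dist_ball (R : realType) (rho : R) (z w : R * R) :
  cell R z -> cell R w -> channel_dist z w <= rho ->
  xball z.1 rho w.1 /\ `|z.2 - w.2| <= rho.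
Proof.
move=> cz cw H; have [H2 [k Hk H1]] := channel_dist_shift cz cw.
split; last exact: le_trans H2 H.
have := le_trans H1 H; rewrite ler_norml => /andP[? ?].
rewrite /xball /= !in_itv /=.
by case: Hk => ?; [left|right; left|right; right]; apply/andP; split; lra.
Qed.

Lemma measurable_xball (R : realType) (x0 rho : R) : measurable (xball x0 rho).
Proof.
by apply: measurableU; [|apply: measurableU]; exact: measurable_itv.
Qed.

Lemma segment_measure (R : realType) (a b : R) : a <= b ->
  lebesgue_measure `[a, b] = (b - a)%:E :> \bar R.
Proof.
move=> ab; rewrite lebesgue_measure_itv /= lte_fin.
case: ltP => [//|ba]; have -> : a = b by apply/eqP; rewrite eq_le ab ba.
by rewrite subrr.
Qed.

Lemma xball_measure (R : realType) (x0 rho : R) : 0 <= rho ->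
  (lebesgue_measure (xball x0 rho) <= (6 * rho)%:E)%E.
Proof.
move=> r0; rewrite /xball.
have mi a b : measurable (`[a, b]%classic : set R) by exact: measurable_itv.
apply: le_trans.
  by apply: measureU2 => //; apply: measurableU.
apply: le_trans.
  by apply: leeD2l; apply: measureU2.
rewrite /= !segment_measure; [|lra|lra|lra].
by rewrite -!EFinD lee_fin; lra.
Qed.

Definition ystrip (R : realType) (t : R) : set (R * R) := setT `*` `[- t, t].

Lemma measurable_ystrip (R : realType) (t : R) : measurable (ystrip t).
Proof. by apply: measurableX => //; exact: measurable_itv. Qed.

Lemma leb2_ystrip (R : realType) (t : R) : 0 <= t ->
  (leb2 R (ystrip t `&` cell R) <= (4 * pi * t)%:E)%E.
Proof.
move=> t0; have mi : measurable (`[0, 2 * pi[ `*` `[- t, t] : set (R * R)).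
  by apply: measurableX; exact: measurable_itv.
have pi0 := pi_gt0 R.
apply: (@le_trans _ _ (leb2 R (`[0, 2 * pi[ `*` `[- t, t]))).
  apply: le_measure; rewrite ?inE //.
    by apply: measurableI; [exact: measurable_ystrip | exact: measurable_cell].
  by move=> [x y] [[/= _ yt] [/= x0 _]].
rewrite /leb2 product_measure1E /=; [|exact: measurable_itv|exact: measurable_itv].
rewrite segment_measure; last by lra.
rewrite lebesgue_measure_itv /= lte_fin mulr_gt0 ?pi_gt0 //.
by rewrite -EFinB -EFinM lee_fin; lra.
Qed.

Lemma indic_ystrip (R : realType) (t : R) (z : R * R) :
  \1_(ystrip t) z = (`|z.2| <= t)%R%:R :> R.
Proof.
rewrite indicE; congr (nat_of_bool _)%:R.
apply/idP/idP; rewrite inE /ystrip /= in_itv /= ler_norml; first by case.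
by move=> H; split.
Qed.

(** The gain of a factor [b] comes from the fact that the integrand vanishes
    unless one of the two points lies in the strip of half-width [b].  At
    distance at most [rho], if [z] is in the strip then [w] ranges over an area of
    order [rho ^ 2] and [z] over an area of order [b]; if only [w] is in the
    strip, then [w] ranges over an area of order [rho * min rho b] and [z] over an
    area of order [b + rho].  Both products are of order [b * rho ^ 2], and
    [dyadic_kernel] sums them over the scales; convergence needs [r < th]. *)
Lemma gagliardo_bound (R : realType) (r th : R) : 0 < r -> r < th -> th < r + 1 ->
  exists2 K : R, 0 <= K & forall (g : R * R -> R) (b B : R), 0 < b -> 0 <= B ->
    (forall z w, cell R z -> cell R w ->
      (g z - g w) ^+ 2 <= B * channel_dist z w `^ (2 * th)) ->
    (forall z, cell R z -> b < `|z.2| -> g z = 0) ->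
    (gagliardo_sq r g <= (K * (b * B))%:E)%E.
Proof.
move=> r_gt0 rth th1.
have pi0 := pi_gt0 R.
have [|//|c [rho [K0 [c0 rho0 K00 Ksum Hdy]]]] :=
  @dyadic_kernel R (2 * pi + 2) (2 * th - 2 * r); [lra| |].
  by apply/andP; split; lra.
exists (144 * pi * K0) => [|g b B b0 B0 Hg g0].
  by rewrite !mulr_ge0 // ltW.
pose m n := Num.min (rho n) b.
have m0 n : 0 <= m n by rewrite /m le_min !ltW.
(* [E n z] contains the points [w] within [rho n] of [z] such that [z] or [w] is
   in the strip; for [z] outside the strip the vertical section has length at
   most [2 * m n], and is empty if the strip is out of reach *)
pose Y n (y : R) : set R :=
  if `|y| <= b then `[y - rho n, y + rho n]%classic
  else if `|y| <= b + rho n then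
    if rho n <= b then `[y - rho n, y + rho n]%classic else `[- b, b]%classic
  else set0.
pose E n (z : R * R) : set (R * R) := xball z.1 (rho n) `*` Y n z.2.
have mY n y : measurable (Y n y) by rewrite /Y; do 3 case: ifP => _ //; exact: measurable_itv.
have mE n z : measurable (E n z).
  by apply: measurableX; [exact: measurable_xball | exact: mY].
(* [12 = 6 * 2]: three segments of length [2 * rho] in x, and one in y *)
pose k1 n := B * c n * (12 * rho n ^+ 2).
pose k2 n := B * c n * (12 * rho n * m n).
have Bc0 n : 0 <= B * c n by rewrite mulr_ge0.
have k10 n : 0 <= k1 n by rewrite /k1 mulr_ge0 // mulr_ge0 // sqr_ge0.
have k20 n : 0 <= k2 n by rewrite /k2 !mulr_ge0 // ltW.
pose h n (z : R * R) : R := k1 n * \1_(ystrip b) z + k2 n * \1_(ystrip (b + rho n)) z.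
have Y_measure n y : (lebesgue_measure (Y n y) <=
    (2 * rho n * (`|y| <= b)%R%:R + 2 * m n * (`|y| <= b + rho n)%R%:R)%:E)%E.
  have := rho0 n; move: (m0 n); rewrite /Y /m => m0n rn0.
  case: (lerP `|y| b) => yb.
    rewrite segment_measure; last by lra.
    rewrite lee_fin mulr1 (_ : y + _ - _ = 2 * rho n); last by ring.
    by rewrite lerDl mulr_ge0 // mulr_ge0.
  rewrite mulr0 add0r; case: ifP => ybr; last by rewrite measure0 lee_fin mulr0.
  rewrite mulr1 minEle; case: ifP => rb.
    by rewrite segment_measure ?lee_fin; lra.
  by rewrite segment_measure ?lee_fin; lra.
have E_measure n z : (leb2 R (E n z `&` cell R) <=
    (6 * rho n * (2 * rho n * (`|z.2| <= b)%R%:R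
                  + 2 * m n * (`|z.2| <= b + rho n)%R%:R))%:E)%E.
  apply: (@le_trans _ _ (leb2 R (E n z))).
    apply: le_measure => [||w [] //]; rewrite inE //.
      by apply: measurableI; [exact: mE | exact: measurable_cell].
    exact: mE.
  rewrite /leb2 /E product_measure1E; [|exact: measurable_xball|exact: mY].
  rewrite EFinM; apply: lee_pmul; [exact: measure_ge0 | exact: measure_ge0 | |].
    by apply: xball_measure; exact: ltW.
  exact: Y_measure.
have pointwise z w : cell R z -> cell R w ->
    (((g z - g w) ^+ 2 / channel_dist z w `^ (2 + 2 * r))%:E <=
     \sum_(0 <= n <oo) (B * c n * \1_(E n z) w)%:E)%E.
  move=> cz cw; set d := channel_dist z w.
  have term0 k : (0 <= (B * c k * \1_(E k z) w)%:E)%E by rewrite lee_fin mulr_ge0.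
  have [gg|gg] := eqVneq (g z) (g w).
    by rewrite gg subrr expr0n mul0r nneseries_ge0.
  have [d0|d0] := eqVneq d 0.
    rewrite d0 powR0; last by apply/negP => /eqP; lra.
    by rewrite invr0 mulr0 nneseries_ge0.
  have dpos : 0 < d by rewrite lt_neqAle eq_sym d0 channel_dist_ge0.
  have [|n [dn cn]] := Hdy d; first by rewrite dpos channel_dist_le_diam.
  apply: le_trans (term_le_nneseries n term0).
  have [xw yw] := channel_dist_ball cz cw dn.
  have Ew : E n z w.
    split => //=; rewrite /Y; case: (lerP `|z.2| b) => zb.
      by rewrite /= in_itv /=; move: yw; rewrite ler_norml => /andP[? ?]; apply/andP; split; lra.
    have wb : `|w.2| <= b.
      rewrite leNgt; apply/negP => wb.
      by move: gg; rewrite !g0 ?eqxx.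
    have zw : `|z.2| <= b + rho n.
      rewrite -[z.2](subrK w.2) addrC; apply: le_trans (ler_normD _ _) _.
      exact: lerD.
    rewrite zw; case: ifP => _; rewrite /= in_itv /= -?ler_norml //.
    by move: yw; rewrite ler_norml => /andP[? ?]; apply/andP; split; lra.
  rewrite indicE mem_set // mulr1 lee_fin.
  apply: (@le_trans _ _ (B * d `^ (2 * th) / d `^ (2 + 2 * r))).
    by rewrite ler_pM2r ?invr_gt0 ?powR_gt0 //; exact: Hg.
  rewrite -mulrA ler_wpM2l // -powRB; last by rewrite d0 implybT.
  by rewrite (_ : _ - _ = - (2 - (2 * th - 2 * r))) //; ring.
have inner z : cell R z ->
    (\int[leb2 R]_(w in cell R)
       ((g z - g w) ^+ 2 / channel_dist z w `^ (2 + 2 * r))%:E <=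
     \sum_(0 <= n <oo) (h n z)%:E)%E.
  move=> cz; apply: le_trans.
    apply: le_integral_ge0 => w cw; last exact: pointwise.
    by rewrite lee_fin divr_ge0 ?sqr_ge0 ?powR_ge0.
  rewrite integral_nneseries; [|exact: measurable_cell| |]; last 2 first.
  - move=> n; apply/measurable_EFinP; apply: measurable_funM => //.
    by apply: measurable_funTS; apply: measurable_indic; exact: mE.
  - by move=> n w _; rewrite lee_fin mulr_ge0.
  apply: lee_nneseries => [n _ _|n _]; first by apply: integral_ge0 => w _; rewrite lee_fin mulr_ge0.
  rewrite integral_scaled_indic; [|exact: measurable_cell|exact: mE|exact: Bc0].
  apply: le_trans (lee_wpmul2l _ (E_measure n z)) _; first by rewrite lee_fin.
  rewrite -EFinM lee_fin /h !indic_ystrip /k1 /k2 le_eqVlt.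
  by apply/orP; left; apply/eqP; ring.
apply: (@le_trans _ _ (\int[leb2 R]_(z in cell R) \sum_(0 <= n <oo) (h n z)%:E)%E).
  apply: le_integral_ge0 => z cz; last exact: inner.
  by apply: integral_ge0 => w _; rewrite lee_fin divr_ge0 ?sqr_ge0 ?powR_ge0.
have h0 n z : 0 <= h n z by rewrite /h addr_ge0 // mulr_ge0.
have mh t : measurable_fun (cell R) (\1_(ystrip t) : R * R -> R).
  by apply: measurable_funTS; apply: measurable_indic; exact: measurable_ystrip.
rewrite integral_nneseries; [|exact: measurable_cell| |]; last 2 first.
- move=> n; apply/measurable_EFinP.
  by apply: measurable_funD; (apply: measurable_funM => //; exact: mh).
- by move=> n z _; rewrite lee_fin.
apply: (@le_trans _ _ (\sum_(0 <= n <oo) ((144 * pi * (b * B))%:E *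
  (c n * rho n ^+ 2)%:E))%E); last first.
  rewrite nneseriesZl; last by move=> n _; rewrite lee_fin mulr_ge0 ?sqr_ge0.
  apply: le_trans (lee_wpmul2l _ Ksum) _; first by rewrite lee_fin !mulr_ge0 // ltW.
  by rewrite -EFinM lee_fin le_eqVlt; apply/orP; left; apply/eqP; ring.
apply: lee_nneseries => [n _ _|n _]; first by apply: integral_ge0 => z _; rewrite lee_fin.
have mC : measurable (cell R) by exact: measurable_cell.
have hE : (\int[leb2 R]_(z in cell R) (h n z)%:E =
    (k1 n)%:E * leb2 R (ystrip b `&` cell R) +
    (k2 n)%:E * leb2 R (ystrip (b + rho n) `&` cell R))%E.
  apply: etrans (congr2 +%E
    (integral_scaled_indic (leb2 R) mC (measurable_ystrip b) (k10 n))
    (integral_scaled_indic (leb2 R) mC (measurable_ystrip (b + rho n)) (k20 n))).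
  transitivity (\int[leb2 R]_(z in cell R) ((k1 n * \1_(ystrip b) z)%:E +
      (k2 n * \1_(ystrip (b + rho n)) z)%:E))%E; first exact: eq_integral.
  apply: ge0_integralD => //.
  - by move=> z _; rewrite lee_fin mulr_ge0.
  - by apply/measurable_EFinP; apply: measurable_funM => //; exact: mh.
  - by move=> z _; rewrite lee_fin mulr_ge0.
  - by apply/measurable_EFinP; apply: measurable_funM => //; exact: mh.
rewrite hE {hE}.
have br0 : 0 <= b + rho n by rewrite addr_ge0 // ltW.
have H1 := lee_wpmul2l (_ : 0 <= (k1 n)%:E)%E (leb2_ystrip (ltW b0)).
have H2 := lee_wpmul2l (_ : 0 <= (k2 n)%:E)%E (leb2_ystrip br0).
apply: le_trans (leeD (H1 _) (H2 _)) _; rewrite ?lee_fin //.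
rewrite /k1 /k2.
have mb : (b + rho n) * m n <= 2 * (b * rho n).
  have rn := rho0 n; rewrite /m minEle; case: ifP => rb.
    by nra.
  have br : b < rho n by rewrite ltNge rb.
  by nra.
have kpos : 0 <= B * c n * (48 * pi * rho n) by rewrite mulr_ge0 // !mulr_ge0 // ltW.
have := ler_wpM2l kpos mb.
rewrite -subr_ge0 => Hk; rewrite -subr_ge0; apply: le_trans Hk _.
by rewrite le_eqVlt; apply/orP; left; apply/eqP; ring.
Qed.

Lemma L2sq_bound (R : realType) (g : R * R -> R) (b B : R) : 0 < b -> 0 <= B ->
  (forall z, cell R z -> (g z) ^+ 2 <= B) ->
  (forall z, cell R z -> b < `|z.2| -> g z = 0) ->
  (L2sq g <= (4 * pi * (b * B))%:E)%E.
Proof.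
move=> b0 B0 gB g0.
apply: (@le_trans _ _ (\int[leb2 R]_(z in cell R) (B * \1_(ystrip b) z)%:E)%E).
  apply: le_integral_ge0 => z cz; rewrite lee_fin ?sqr_ge0 // indic_ystrip.
  case: (lerP `|z.2| b) => zb; first by rewrite mulr1 gB.
  by rewrite g0 // expr0n mulr0.
rewrite integral_scaled_indic //; [|exact: measurable_cell|exact: measurable_ystrip].
apply: le_trans (lee_wpmul2l _ (leb2_ystrip (ltW b0))) _; first by rewrite lee_fin.
by rewrite -EFinM lee_fin le_eqVlt; apply/orP; left; apply/eqP; ring.
Qed.

(** A bound [A] and a Lipschitz bound [L * d] give a Hoelder bound of exponent
    [th], because [min 1 t <= t `^ th]. *)
Lemma interpolate_sqr (R : realType) (x A L d th : R) : 0 < A -> 0 < L ->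
  0 <= d -> 0 <= th <= 1 -> `|x| <= A -> `|x| <= L * d ->
  x ^+ 2 <= A ^+ 2 * (L / A) `^ (2 * th) * d `^ (2 * th).
Proof.
move=> A0 L0 d0 /andP[th0 th1] xA xL.
have LA0 : 0 <= L / A by rewrite divr_ge0 ?ltW.
rewrite -mulrA -powRM //; set t := L / A * d.
have t0 : 0 <= t by rewrite mulr_ge0.
have xt : `|x| <= A * t by rewrite /t mulrA mulrCA divff ?mulr1 // gt_eqF.
rewrite -[x ^+ 2]real_normK ?num_real //.
have [t1|t1] := lerP 1 t.
  apply: (@le_trans _ _ (A ^+ 2)); first by rewrite ler_pXn2r ?nnegrE // ltW.
  rewrite ler_peMr ?sqr_ge0 // -[leLHS](powRr0 t) ler_powR //.
  by rewrite mulr_ge0.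
apply: (@le_trans _ _ ((A * t) ^+ 2)).
  by rewrite ler_pXn2r ?nnegrE // mulr_ge0 // ltW.
rewrite exprMn ler_wpM2l ?sqr_ge0 //.
have [->|tn0] := eqVneq t 0; first by rewrite expr0n powR_ge0.
rewrite -powR_mulrn // ger_powR //; first by rewrite lt_neqAle eq_sym tn0 t0 ltW.
by rewrite ler_piMr.
Qed.

Lemma powR_small (R : realType) (p C tau : R) : 0 < p -> 0 <= C -> 0 < tau ->
  exists2 e0, 0 < e0 & forall e, 0 < e <= e0 -> C * e `^ p < tau.
Proof.
move=> p0 C0 tau0; pose t := tau / (C + 1).
have C1 : 0 < C + 1 by rewrite ltr_wpDl.
have t0 : 0 < t by rewrite divr_gt0.
exists (t `^ p^-1) => [|e /andP[e0 et]]; first exact: powR_gt0.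
have : e `^ p <= t.
  rewrite -[leRHS](powRr1 (ltW t0)) -(mulVf (lt0r_neq0 p0)) powRrM.
  by apply: ge0_ler_powR; rewrite ?nnegrE ?powR_ge0 //; exact: ltW.
move=> H; apply: (@le_lt_trans _ _ (C * t)); first by rewrite ler_wpM2l.
by rewrite /t mulrA ltr_pdivrMr // mulrC ltr_pM2l // ltrDl.
Qed.

(** The estimates obeyed by [e * F (y / e)] when the derivative of [F] is Lipschitz
    and compactly supported; [M] is meant to be independent of [e]. *)
Definition concentrated (R : realType) (M e : R) (f g1 g2 : R * R -> R) : Prop :=
  [/\ forall z, cell R z -> `|f z| <= M * e,
      forall z w, cell R z -> cell R w -> `|f z - f w| <= M * channel_dist z w &
      forall g, g = g1 \/ g = g2 ->
        [/\ forall z, cell R z -> `|g z| <= M,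
            forall z w, cell R z -> cell R w ->
              `|g z - g w| <= M / e * channel_dist z w &
            forall z, cell R z -> 2 * e < `|z.2| -> g z = 0]].

Lemma sqr_le_norm (R : realType) (x A : R) : `|x| <= A -> x ^+ 2 <= A ^+ 2.
Proof.
move=> xA; rewrite -[x ^+ 2]real_normK ?num_real // ler_pXn2r ?nnegrE //.
exact: le_trans (normr_ge0 _) xA.
Qed.

(** Interpolation with an exponent [th] slightly larger than [r] makes the kernel
    of [gagliardo_bound] integrable, and costs the factor [e `^ (- (2 * th))]. *)
Lemma slobodeckij_bound (R : realType) (r th : R) : 0 <= r -> r < th <= 1 ->
  exists2 K : R, 0 <= K & forall (g : R * R -> R) (b A e : R),
    0 < b -> 0 < A -> 0 < e <= 1 ->
    (forall z, cell R z -> `|g z| <= A) ->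
    (forall z w, cell R z -> cell R w ->
      `|g z - g w| <= A / e * channel_dist z w) ->
    (forall z, cell R z -> b < `|z.2| -> g z = 0) ->
    (sobolev_sq 0 r g <= (K * (b * (A ^+ 2 * e `^ (- (2 * th)))))%:E)%E.
Proof.
move=> r0 /andP[rth th1]; have pi0 := pi_gt0 R.
have L2 (g : R * R -> R) (b A e : R) : 0 < b -> 0 < A -> 0 < e <= 1 ->
    (forall z, cell R z -> `|g z| <= A) ->
    (forall z, cell R z -> b < `|z.2| -> g z = 0) ->
    (L2sq g <= (4 * pi * (b * (A ^+ 2 * e `^ (- (2 * th)))))%:E)%E.
  move=> b0 A0 /andP[e0 e1] gA g0.
  have e_ge1 : 1 <= e `^ (- (2 * th)).
    rewrite -[leLHS](powRr0 e); apply: ger_powR; first by rewrite e0.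
    by rewrite oppr_le0 mulr_ge0 //; lra.
  apply: le_trans (L2sq_bound b0 (sqr_ge0 A) _ g0) _ => [z cz|].
    by apply: sqr_le_norm; exact: gA.
  rewrite lee_fin; apply: ler_wpM2l; first by rewrite mulr_ge0 // ltW.
  apply: ler_wpM2l; first exact: ltW.
  by rewrite ler_peMr // sqr_ge0.
have [r_0|rn0] := eqVneq r 0.
  exists (4 * pi) => [|g b A e b0 A0 e01 gA _ g0]; first by rewrite mulr_ge0 // ltW.
  by rewrite /sobolev_sq r_0 eqxx; exact: L2.
have rgt0 : 0 < r by rewrite lt_neqAle eq_sym rn0.
have thr : th < r + 1 by lra.
have [K K0 HK] := gagliardo_bound rgt0 rth thr.
exists (4 * pi + K * 4) => [|g b A e b0 A0 e01 gA gL g0].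
  by rewrite addr_ge0 // mulr_ge0 // ltW.
have /andP[e0 e1] := e01.
rewrite /sobolev_sq (negbTE rn0) mulrDl EFinD; apply: leeD; first exact: L2.
have A20 : 0 < 2 * A by rewrite mulr_gt0.
have Ae0 : 0 < A / e by rewrite divr_gt0.
have th01 : 0 <= th <= 1 by apply/andP; split; lra.
apply: le_trans (HK g b ((2 * A) ^+ 2 * ((A / e) / (2 * A)) `^ (2 * th)) b0 _ _ g0) _.
- by rewrite mulr_ge0 ?sqr_ge0 ?powR_ge0.
- move=> z w cz cw; apply: interpolate_sqr => //; last exact: gL.
    exact: channel_dist_ge0.
  rewrite (_ : 2 * A = A + A); last by ring.
  by apply: le_trans (ler_normB _ _) _; apply: lerD; exact: gA.
rewrite lee_fin -[leRHS]mulrA; apply: ler_wpM2l => //.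
rewrite [leRHS]mulrCA; apply: ler_wpM2l; first exact: ltW.
rewrite exprMn (_ : 2 ^+ 2 = 4 :> R); last by ring.
rewrite -[leLHS]mulrA; apply: ler_wpM2l => //; apply: ler_wpM2l; first exact: sqr_ge0.
rewrite (_ : A / e / (2 * A) = 2^-1 * e^-1); last by field; rewrite !gt_eqF.
rewrite powRM ?invr_ge0 ?(ltW e0) //.
rewrite -[e^-1](powR_inv1 (ltW e0)) -powRrM mulN1r ler_piMl ?powR_ge0 //.
rewrite -[leRHS](powRr0 2^-1); apply: ger_powR; first by apply/andP; split; lra.
by rewrite mulr_ge0 //; lra.
Qed.

Lemma sqrte_lt (R : realType) (x : \bar R) (eps : R) : 0 < eps ->
  (x < (eps ^+ 2)%:E)%E -> (sqrte x < eps%:E)%E.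
Proof.
move=> eps0; case: x => [x||] //=; rewrite !lte_fin => H.
by rewrite -[ltRHS](gtr0_norm eps0) -sqrtr_sqr ltr_sqrt // exprn_gt0.
Qed.

(** For [1 <= s] the gradient contributes [e * e `^ (- (2 * th))] with
    [s - 1 < th]: the first factor is the width of the strip.  This tends to zero
    for some admissible [th] exactly when [s < 3 / 2]. *)
Lemma Hs_norm_small (R : realType) (s M eps : R) : 0 <= s -> s < 3 / 2 ->
  0 < M -> 0 < eps -> exists2 e0, 0 < e0 & forall e (f g1 g2 : R * R -> R),
    0 < e <= e0 -> C1 f g1 g2 -> xperiodic f -> concentrated M e f g1 g2 ->
    (Hs_norm s f < eps%:E)%E.
Proof.
move=> s0 s32 M0 eps0; have pi0 := pi_gt0 R.
have eps20 : 0 < eps ^+ 2 by rewrite exprn_gt0.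
suff [e0 e00 He] : exists2 e0, 0 < e0 & forall e (f g1 g2 : R * R -> R),
    0 < e <= e0 -> C1 f g1 g2 -> xperiodic f -> concentrated M e f g1 g2 ->
    (sobolev_sq (Num.truncn s) (s - (Num.truncn s)%:R) f < (eps ^+ 2)%:E)%E.
  exists e0 => // e f g1 g2 ee Hf pf Hc.
  by apply: sqrte_lt => //; exact: He Hf pf Hc.
have [s1|s1] := ltrP s 1.
  have -> : Num.truncn s = 0%N by apply/truncn_def; rewrite s0 s1.
  rewrite subr0; pose th := (s + 1) / 2.
  have [|K K0 HK] := @slobodeckij_bound R s th s0.
    by rewrite /th; apply/andP; split; lra.
  have [||a a0 Ha] := @powR_small R (2 - 2 * th) (K * M ^+ 2) (eps ^+ 2) _ _ eps20.
  - by rewrite /th; lra.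
  - by rewrite mulr_ge0 ?sqr_ge0.
  exists (Num.min a 1) => [|e f g1 g2 /andP[e0]]; first by rewrite lt_min a0 ltr01.
  rewrite le_min => /andP[ea e1] _ _ [fM fL _].
  apply: le_lt_trans (HK f 1 (M * e) e ltr01 _ _ _ _ _) _ => //.
  - by rewrite mulr_gt0.
  - by rewrite e0.
  - by move=> z w cz cw; rewrite mulfK ?gt_eqF //; exact: fL.
  - move=> z [_ /=]; rewrite in_itv /= => /andP[z1 z2].
    by rewrite ltNge ler_norml z1 z2.
  rewrite lte_fin; apply: le_lt_trans (Ha e _); last by rewrite e0.
  rewrite powRB; last by rewrite (gt_eqF e0) implybT.
  rewrite powR_mulrn ?(ltW e0) // powRN le_eqVlt.
  by apply/orP; left; apply/eqP; ring.
have -> : Num.truncn s = 1%N by apply/truncn_def; rewrite s1; lra.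
pose r := s - 1; pose th := (r + 1 / 2) / 2.
have r0 : 0 <= r by rewrite /r subr_ge0.
have [|K K0 HK] := @slobodeckij_bound R r th r0.
  by rewrite /th /r; apply/andP; split; lra.
have eps30 : 0 < eps ^+ 2 / 3 by rewrite divr_gt0.
have [||a a0 Ha] := @powR_small R (1 - 2 * th) (K * (2 * M ^+ 2)) (eps ^+ 2 / 3) _ _ eps30.
- by rewrite /th /r; lra.
- by rewrite mulr_ge0 // mulr_ge0 // sqr_ge0.
have [||b b0 Hb] := @powR_small R 2 (4 * pi * M ^+ 2) (eps ^+ 2 / 3) _ _ eps30 => //.
- by rewrite mulr_ge0 ?sqr_ge0 // mulr_ge0 // ltW.
exists (Num.min (Num.min a b) 1) => [|e f g1 g2 /andP[e0]].
  by rewrite !lt_min a0 b0 ltr01.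
rewrite !le_min => /andP[/andP[ea eb] e1] Hf pf [fM _ gM].
have [w1 w2] := weak_partial_C1 Hf pf.
apply: le_lt_trans (ereal_inf_lbound _) _; first by exists g1, g2; split.
rewrite (_ : (eps ^+ 2)%:E = ((eps ^+ 2 / 3)%:E +
  ((eps ^+ 2 / 3)%:E + (eps ^+ 2 / 3)%:E))%E); last first.
  by rewrite -!EFinD; congr EFin; field.
have S g : g = g1 \/ g = g2 -> (sobolev_sq 0 r g < (eps ^+ 2 / 3)%:E)%E.
  move=> /gM[gA gL g0]; apply: le_lt_trans (HK g (2 * e) M e _ _ _ gA gL g0) _ => //.
  - by rewrite mulr_gt0.
  - by rewrite e0.
  rewrite lte_fin; apply: le_lt_trans (Ha e _); last by rewrite e0.
  rewrite powRB; last by rewrite (gt_eqF e0) implybT.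
  rewrite powRr1 ?(ltW e0) // powRN le_eqVlt.
  by apply/orP; left; apply/eqP; ring.
apply: lteD; last by apply: lteD; apply: S; [left | right].
apply: le_lt_trans (L2sq_bound (b := 1) (B := (M * e) ^+ 2) _ _ _ _) _ => //.
- exact: sqr_ge0.
- by move=> z cz; apply: sqr_le_norm; exact: fM.
- move=> z [_ /=]; rewrite in_itv /= => /andP[z1 z2].
  by rewrite ltNge ler_norml z1 z2.
rewrite lte_fin; apply: le_lt_trans (Hb e _); last by rewrite e0.
by rewrite powR_mulrn ?(ltW e0) // le_eqVlt; apply/orP; left; apply/eqP; ring.
Qed.

(** * The flattened Poiseuille flow *)

Definition ppow (R : realType) (n : nat) (t : R) : R := Num.max t 0 ^+ n.

Lemma ppow_pos (R : realType) (n : nat) (t : R) : 0 <= t -> ppow n t = t ^+ n.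
Proof. by move=> t0; rewrite /ppow max_l. Qed.

Lemma ppow_neg (R : realType) (n : nat) (t : R) : t <= 0 -> ppow n.+1 t = 0.
Proof. by move=> t0; rewrite /ppow max_r // expr0n. Qed.

Lemma continuous_ppow (R : realType) (n : nat) : continuous (@ppow R n).
Proof.
have cmax : continuous (fun t : R => Num.max t 0).
  rewrite (_ : (fun t => _) = (fun t : R => (t + `|t|) * 2^-1)); last first.
    by apply/funext => t; rewrite maxr_absE addr0 subr0.
  move=> t; apply: cvgM; last exact: cvg_cst.
  by apply: cvgD; [exact: cvg_id | apply: cvg_norm; exact: cvg_id].
elim: n => [|n IH].
  by move=> t; rewrite (_ : @ppow R 0 = cst 1); [exact: cvg_cst | apply/funext].
rewrite (_ : @ppow R n.+1 = (fun t => Num.max t 0 * ppow n t)).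
  exact: continuous_mul.
by apply/funext => t; rewrite /ppow exprS.
Qed.

Lemma is_derive_ppow (R : realType) (n : nat) (t : R) :
  is_derive t 1 (@ppow R n.+2) (n.+2%:R * ppow n.+1 t).
Proof.
have [t0|t0|->] := ltrgtP t 0.
- rewrite ppow_neg ?ltW // mulr0.
  apply: (@near_eq_is_derive _ _ _ (cst 0)).
  by near=> u; rewrite ppow_neg //; apply: ltW; near: u; exact: lt_nbhsl.
- rewrite ppow_pos ?ltW //.
  have D : is_derive t 1 (@id R) 1 by exact: is_derive_id.
  have := is_deriveX n.+2 D; rewrite /GRing.scale /= mulr1 => DX.
  apply: (near_eq_is_derive _ DX).
  near=> u; rewrite ppow_pos ?exprfctE //; apply: ltW; near: u.
  exact: lt_nbhsr.
- rewrite ppow_neg // mulr0.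
  suff H : (fun h : R => h^-1 *: ((@ppow R n.+2 \o shift 0) (h *: 1) - ppow n.+2 0))
      @ 0^' --> (0 : R).
    by split; [exact: cvgP H | exact: cvg_lim H].
  apply: (@cvg_to_0_linear _ _ 1 1) => // h /andP[h0 h1] /=.
  have P0 : @ppow R n.+2 0 = 0 by exact: ppow_neg.
  rewrite addr0 [h *: 1]mulr1 P0 subr0 /GRing.scale /= mul1r.
  have [hn|hp] := lerP h 0; first by rewrite ppow_neg // mulr0 normr0.
  rewrite ppow_pos; last exact: ltW.
  rewrite exprS mulKf ?gt_eqF // normrX exprS -[leRHS]mulr1 ler_wpM2l //.
  by rewrite exprn_ile1 // ltW.
Unshelve. all: by end_near. Qed.

Lemma lipschitz_of_derive (R : realType) (F f : R -> R) (L a b : R) :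
  (forall t : R, is_derive t 1 F (f t)) -> (forall t, `|f t| <= L) ->
  `|F a - F b| <= L * `|a - b|.
Proof.
move=> dF fL; wlog ab : a b / b <= a.
  move=> H; have /orP[|ba] := le_total b a; first exact: H.
  by rewrite distrC [`|a - b|]distrC; exact: H.
have cF : continuous F by move=> t; exact: is_derive_continuous (dF t).
have [|c _ ->] := @MVT_segment R F f b a ab (fun t _ => dF t).
  exact: continuous_subspaceT.
by rewrite normrM ler_wpM2r.
Qed.

Lemma C1_lipschitz (R : realType) (f fx fy : R * R -> R) (L : R) (z w : R * R) :
  C1 f fx fy -> (forall z, `|fx z| <= L) -> (forall z, `|fy z| <= L) ->
  `|f z - f w| <= L * (`|z.1 - w.1| + `|z.2 - w.2|).
Proof.
move=> Hf fxL fyL; case: z w => [x y] [x' y'] /=.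
rewrite -(subrK (f (x', y)) (f (x, y))) -addrA mulrDr.
apply: le_trans (ler_normD _ _) _; apply: lerD.
  apply: (@lipschitz_of_derive R (fun x => f (x, y)) (fun x => fx (x, y))) => // t.
  exact: (C1_dx t y Hf).
apply: (@lipschitz_of_derive R (fun y => f (x', y)) (fun y => fy (x', y))) => // t.
exact: (C1_dy x' t Hf).
Qed.

Lemma C1_channel_lipschitz (R : realType) (f fx fy : R * R -> R) (L : R)
    (z w : R * R) : C1 f fx fy -> xperiodic f ->
  (forall z, `|fx z| <= L) -> (forall z, `|fy z| <= L) ->
  cell R z -> cell R w -> `|f z - f w| <= 2 * L * channel_dist z w.
Proof.
move=> Hf pf fxL fyL cz cw; have [H2 [k Hk H1]] := channel_dist_shift cz cw.
have fk : f z = f (z.1 + k, z.2).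
  case: z {cz H1 H2} => x y /=; case: Hk => ->; rewrite ?addr0 ?pf //.
  by rewrite -[in RHS]pf subrK.
rewrite fk; apply: le_trans (C1_lipschitz _ _ Hf fxL fyL) _ => /=.
have L0 : 0 <= L by exact: le_trans (normr_ge0 _) (fxL z).
rewrite -mulrA mulrCA; apply: ler_wpM2l => //.
by rewrite mulr_natl mulr2n; exact: lerD.
Qed.

(** [shear e 2] is the odd function that vanishes for [`|t| <= e], has slope one
    for [2 * e <= `|t|], and whose slope [shear e 1] is linear in between; the
    higher [shear e k] are its successive primitives that vanish near zero. *)
Definition shear (R : realType) (e : R) (k : nat) (t : R) : R :=
  (ppow k (t - e) - ppow k (t - 2 * e)
   + (-1) ^+ k.+1 * (ppow k (- t - e) - ppow k (- t - 2 * e))) / (k`!%:R * e).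

Lemma is_derive_ppow_affine (R : realType) (n : nat) (a b t : R) :
  is_derive t 1 (fun t => @ppow R n.+2 (a * t + b))
    (a * (n.+2%:R * ppow n.+1 (a * t + b))).
Proof.
have D : is_derive t 1 (fun t : R => a * t + b) a.
  apply: (is_derive_eq (is_deriveD (is_deriveZ a (is_derive_id t 1)) (is_derive_cst b t 1))).
  by rewrite addr0 [_ *: _]mulr1.
have := @is_derive1_comp R (@ppow R n.+2) (fun t => a * t + b) t _ _
  (is_derive_ppow n (a * t + b)) D.
by rewrite [a * (_ * _)]mulrC.
Qed.

Lemma is_derive_shear (R : realType) (e : R) (k : nat) (t : R) : 0 < e ->
  is_derive t 1 (shear e k.+2) (shear e k.+1 t).
Proof.
move=> e0.
have E (s : R) : shear e k.+2 s = (k.+2`!%:R * e)^-1 *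
    (ppow k.+2 (1 * s + - e) - ppow k.+2 (1 * s + - (2 * e))
     + (-1) ^+ k.+1 * (ppow k.+2 (-1 * s + - e) - ppow k.+2 (-1 * s + - (2 * e)))).
  rewrite /shear (_ : (-1) ^+ k.+3 = (-1) ^+ k.+1 :> R); last first.
    by rewrite !exprS !mulN1r opprK.
  by rewrite !mul1r !mulN1r mulrC.
rewrite (funext E).
have D1 := is_derive_ppow_affine k 1 (- e) t.
have D2 := is_derive_ppow_affine k 1 (- (2 * e)) t.
have D3 := is_derive_ppow_affine k (-1) (- (2 * e)) t.
have D4 := is_derive_ppow_affine k (-1) (- e) t.
apply: (is_derive_eq (is_deriveZ _ (is_deriveD (is_deriveB D1 D2)
  (is_deriveZ _ (is_deriveB D4 D3))))).
have k0 : (k.+2%:R : R) != 0 by rewrite pnatr_eq0.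
have f0 : (k.+1`!%:R : R) != 0 by rewrite pnatr_eq0 -lt0n fact_gt0.
rewrite /shear factS natrM /GRing.scale /= !mul1r !mulN1r !exprS.
move: (k.+2%:R) (k.+1`!%:R) k0 f0 => A B A0 B0.
by field; rewrite A0 B0 gt_eqF.
Qed.

Lemma continuous_shear (R : realType) (e : R) (k : nat) : continuous (shear e k).
Proof.
have cp (a b : R) : continuous (fun t => @ppow R k (a * t + b)).
  apply: continuous_compf; last exact: continuous_ppow.
  move=> t; apply: cvgD; last exact: cvg_cst.
  by apply: cvgM; [exact: cvg_cst | exact: cvg_id].
rewrite (_ : shear e k = (fun s => (k`!%:R * e)^-1 *
    (ppow k (1 * s + - e) - ppow k (1 * s + - (2 * e))
     + (-1) ^+ k.+1 * (ppow k (-1 * s + - e) - ppow k (-1 * s + - (2 * e)))))).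
  move=> t; apply: cvgM; first exact: cvg_cst.
  apply: cvgD; first by apply: cvgB; exact: cp.
  by apply: cvgM; [exact: cvg_cst | apply: cvgB; exact: cp].
by apply/funext => s; rewrite /shear !mul1r !mulN1r mulrC.
Qed.

Lemma shear_flat (R : realType) (e : R) (k : nat) (t : R) : 0 < e ->
  `|t| <= e -> shear e k.+1 t = 0.
Proof.
move=> e0; rewrite ler_norml => /andP[t1 t2].
by rewrite /shear !ppow_neg ?subrr ?mulr0 ?addr0 ?mul0r //; lra.
Qed.

Lemma shear_odd4 (R : realType) (e t : R) : shear e 4 (- t) = - shear e 4 t.
Proof.
rewrite /shear opprK; move: (ppow _ _) (ppow _ _) (ppow _ _) (ppow _ _) => a b c d.
by move: (4`!%:R * e)^-1 => f; ring.
Qed.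

Lemma shear1_range (R : realType) (e t : R) : 0 < e -> 0 <= shear e 1 t <= 1.
Proof.
move=> e0; rewrite /shear /= mul1r expr2 mulrNN !mul1r /ppow !expr1.
rewrite ler_pdivrMr // divr_ge0 ?(ltW e0) ?mul1r //.
  by case: (lerP (t - e) 0); case: (lerP (t - 2 * e) 0);
     case: (lerP (- t - e) 0); case: (lerP (- t - 2 * e) 0); lra.
by case: (lerP (t - e) 0); case: (lerP (t - 2 * e) 0);
   case: (lerP (- t - e) 0); case: (lerP (- t - 2 * e) 0); lra.
Qed.

Lemma shear1_outside (R : realType) (e t : R) : 0 < e -> 2 * e <= `|t| ->
  shear e 1 t = 1.
Proof.
move=> e0 te; rewrite /shear /= mul1r expr2 mulrNN !mul1r /ppow !expr1.
rewrite [X in X / e](_ : _ = e) ?divff ?gt_eqF //.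
move: te; rewrite ler_normr => /orP[te|te].
  have -> : Num.max (t - e) 0 = t - e by rewrite max_l //; lra.
  have -> : Num.max (t - 2 * e) 0 = t - 2 * e by rewrite max_l //; lra.
  have -> : Num.max (- t - e) 0 = 0 by rewrite max_r //; lra.
  have -> : Num.max (- t - 2 * e) 0 = 0 by rewrite max_r //; lra.
  by ring.
have -> : Num.max (t - e) 0 = 0 by rewrite max_r //; lra.
have -> : Num.max (t - 2 * e) 0 = 0 by rewrite max_r //; lra.
have -> : Num.max (- t - e) 0 = - t - e by rewrite max_l //; lra.
have -> : Num.max (- t - 2 * e) 0 = - t - 2 * e by rewrite max_l //; lra.
by ring.
Qed.

Lemma ppow1_lipschitz (R : realType) (t u : R) :
  `|@ppow R 1 t - ppow 1 u| <= `|t - u|.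
Proof.
rewrite /ppow !expr1; wlog tu : t u / u <= t.
  move=> H; have /orP[|ut] := le_total u t; first exact: H.
  by rewrite distrC [leRHS]distrC; exact: H.
rewrite [leRHS]ger0_norm ?subr_ge0 //.
have [t0|t0] := lerP t 0.
  by rewrite max_r ?(le_trans tu) // subrr normr0 subr_ge0.
by have [u0|u0] := lerP u 0; rewrite ger0_norm; lra.
Qed.

Lemma shear1_lipschitz (R : realType) (e t u : R) : 0 < e ->
  `|shear e 1 t - shear e 1 u| <= 4 / e * `|t - u|.
Proof.
move=> e0.
have -> : shear e 1 t - shear e 1 u = e^-1 * ((ppow 1 (t - e) - ppow 1 (u - e))
    - (ppow 1 (t - 2 * e) - ppow 1 (u - 2 * e))
    + ((ppow 1 (- t - e) - ppow 1 (- u - e))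
    - (ppow 1 (- t - 2 * e) - ppow 1 (- u - 2 * e)))).
  by rewrite /shear (_ : 1`!%:R = 1 :> R) // !mul1r expr2 mulrNN !mul1r; ring.
rewrite normrM gtr0_norm ?invr_gt0 // (mulrC 4) -mulrA.
rewrite ler_pM2l ?invr_gt0 //.
have L (a b : R) : `|a - b| = `|t - u| -> `|ppow 1 a - ppow 1 b| <= `|t - u|.
  by move=> <-; exact: ppow1_lipschitz.
apply: le_trans (ler_normD _ _) _.
rewrite (_ : 4 * `|t - u| = (`|t - u| + `|t - u|) + (`|t - u| + `|t - u|)); last by ring.
apply: lerD; apply: le_trans (ler_normB _ _) _; apply: lerD; apply: L.
- by congr `|_|; ring.
- by congr `|_|; ring.
- by rewrite -normrN; congr `|_|; ring.
- by rewrite -normrN; congr `|_|; ring.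
Qed.

Lemma shear2_lipschitz (R : realType) (e t u : R) : 0 < e ->
  `|(shear e 2 t - t) - (shear e 2 u - u)| <= `|t - u|.
Proof.
move=> e0; rewrite -[leRHS]mul1r.
apply: (@lipschitz_of_derive R (fun t => shear e 2 t - t) (fun t => shear e 1 t - 1)).
  by move=> s; apply: is_deriveB; exact: is_derive_shear.
by move=> s; have /andP[? ?] := shear1_range s e0; rewrite ler_norml; apply/andP; split; lra.
Qed.

Lemma shear2_close (R : realType) (e t : R) : 0 < e ->
  `|shear e 2 t - t| <= 2 * e.
Proof.
move=> e0.
have s20 : shear e 2 0 = 0 by rewrite shear_flat // normr0 ltW.
have mid u : `|u| <= 2 * e -> `|shear e 2 u - u| <= 2 * e.
  move=> ue; apply: le_trans ue; have := shear2_lipschitz u 0 e0.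
  by rewrite s20 !subr0.
have [te|te] := lerP `|t| (2 * e); first exact: mid.
move: te; rewrite ltNge ler_norml negb_and -!ltNge => /orP[te|te].
- have P1 : Num.max (- t - e) 0 = - t - e by rewrite max_l //; lra.
  have P2 : Num.max (- t - 2 * e) 0 = - t - 2 * e by rewrite max_l //; lra.
  have P3 : Num.max (t - e) 0 = 0 by rewrite max_r //; lra.
  have P4 : Num.max (t - 2 * e) 0 = 0 by rewrite max_r //; lra.
  rewrite /shear /ppow P1 P2 P3 P4 !factS fact0 [X in `|X|](_ : _ = 3 / 2 * e).
    by rewrite ger0_norm; lra.
  by field; rewrite gt_eqF.
- have P1 : Num.max (- t - e) 0 = 0 by rewrite max_r //; lra.
  have P2 : Num.max (- t - 2 * e) 0 = 0 by rewrite max_r //; lra.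
  have P3 : Num.max (t - e) 0 = t - e by rewrite max_l //; lra.
  have P4 : Num.max (t - 2 * e) 0 = t - 2 * e by rewrite max_l //; lra.
  rewrite /shear /ppow P1 P2 P3 P4 !factS fact0 [X in `|X|](_ : _ = - (3 / 2 * e)).
    by rewrite normrN ger0_norm; lra.
  by field; rewrite gt_eqF.
Qed.

Lemma shear4_1_range (R : realType) (e : R) : 0 < e -> e <= 1 / 4 ->
  0 <= shear e 4 1 <= 1 / 6.
Proof.
move=> e0 e4.
have P1 : Num.max (- 1 - e) 0 = 0 by rewrite max_r //; lra.
have P2 : Num.max (- 1 - 2 * e) 0 = 0 by rewrite max_r //; lra.
have P3 : Num.max (1 - e) 0 = 1 - e by rewrite max_l //; lra.
have P4 : Num.max (1 - 2 * e) 0 = 1 - 2 * e by rewrite max_l //; lra.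
rewrite /shear /ppow P1 P2 P3 P4 !factS fact0.
rewrite [X in 0 <= X <= _](_ : _ = (2 - 3 * e) * (2 - 6 * e + 5 * e ^+ 2) / 24); last first.
  by field; rewrite gt_eqF.
by apply/andP; split; nra.
Qed.

(** * Periodisation *)

(** The representative of [x - pi] modulo [2 * pi] in [[- pi, pi[[. *)
Definition xred (R : realType) (x : R) : R :=
  x - 2 * pi * (Num.floor (x / (2 * pi)))%:~R - pi.

Definition perx (R : realType) (K : R * R -> R) (z : R * R) : R :=
  K (xred z.1, z.2).

Lemma xred_floor (R : realType) (x : R) (n : int) :
  2 * pi * n%:~R <= x < 2 * pi * (n%:~R + 1) -> xred x = x - 2 * pi * n%:~R - pi.
Proof.
move=> /andP[x1 x2]; rewrite /xred (floor_def (m := n)) //.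
have p0 : 0 < 2 * pi :> R by rewrite mulr_gt0 // pi_gt0.
by rewrite ler_pdivlMr // ltr_pdivrMr // intrD mulrC x1 mulrC.
Qed.

Lemma xred_itv (R : realType) (x : R) : exists n : int,
  2 * pi * n%:~R <= x < 2 * pi * (n%:~R + 1).
Proof.
exists (Num.floor (x / (2 * pi))); have := floor_itv (x / (2 * pi)).
have p0 : 0 < 2 * pi :> R by rewrite mulr_gt0 // pi_gt0.
by rewrite ler_pdivlMr // ltr_pdivrMr // intrD ![_ * (2 * pi)]mulrC.
Qed.

Lemma perx_xperiodic (R : realType) (K : R * R -> R) : xperiodic (perx K).
Proof.
move=> x y; rewrite /perx /=; congr K; congr pair.
have [n /andP[n1 n2]] := xred_itv x.
rewrite (xred_floor (x := x) (n := n)) ?n1 // (xred_floor (n := n + 1)).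
  by rewrite intrD; ring.
by rewrite intrD; apply/andP; split; lra.
Qed.

Definition x_supported (R : realType) (K : R * R -> R) : Prop :=
  forall z, 1 <= `|z.1| -> K z = 0.

(** Near any point the periodisation is a translate.  The reduction [xred] jumps at
    multiples of [2 * pi], but there both sides vanish, since [1 <= pi - 1]. *)
Lemma perx_near (R : realType) (z : R * R) :
  exists c : R, forall K : R * R -> R, x_supported K ->
    \forall w \near z, K (w.1 + c, w.2) = perx K w.
Proof.
have [n /andP[n1 n2]] := xred_itv z.1; have pi2 := pi_ge2 R.
exists (- (2 * pi * n%:~R) - pi) => K K0.
pose dlt := Num.min 1 (2 * pi * (n%:~R + 1) - z.1).
have dlt0 : 0 < dlt by rewrite lt_min ltr01 subr_gt0.
have : \forall w \near z, `|z.1 - w.1| < dlt.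
  by move/cvgrPdist_lt: (@continuous_fst _ _ z); apply.
apply: filterS => -[x y] /=; rewrite lt_min ltr_norml ltr_norml.
move=> /andP[/andP[a1 a2] /andP[b1 b2]].
rewrite /perx /= addrA.
have [xn|xn] := lerP (2 * pi * n%:~R) x.
  by rewrite (xred_floor (n := n)) //; apply/andP; split; lra.
rewrite (xred_floor (n := n - 1)); last by rewrite intrD; apply/andP; split; lra.
rewrite !K0 //= ?intrD ler_normr; apply/orP; first by left; lra.
by right; lra.
Qed.

Lemma C1_perx (R : realType) (K Kx Ky : R * R -> R) : C1 K Kx Ky ->
  x_supported K -> x_supported Kx -> x_supported Ky ->
  C1 (perx K) (perx Kx) (perx Ky).
Proof.
move=> HK K0 Kx0 Ky0.
have cont (f : R * R -> R) : continuous f -> x_supported f -> continuous (perx f).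
  move=> cf f0 z; have [c /(_ f f0) fc] := perx_near z.
  have zc := nbhs_singleton fc.
  apply: cvg_trans (near_eq_cvg fc) _; rewrite -zc.
  apply: (@continuous_compf _ _ _ (fun w : R * R => (w.1 + c, w.2)) f _ cf z).
  apply: continuous_pairing; last exact: continuous_snd.
  by move=> w; apply: cvgD; [exact: continuous_fst | exact: cvg_cst].
have [c1 c2 c3 _] := HK.
split; try exact: cont.
move=> z v; have [c fc] := perx_near z.
have [_ _ _ D] := C1_translate c HK.
have := D z v; rewrite (nbhs_singleton (fc _ Kx0)) (nbhs_singleton (fc _ Ky0)).
by move=> Dz; apply: (near_eq_is_derive _ Dz); exact: fc.
Qed.

Lemma bounded_of_support (R : realType) (K : R * R -> R) : continuous K ->
  x_supported K -> (forall z, 1 <= `|z.2| -> K z = 0) ->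
  exists2 N, 0 <= N & forall z, `|K z| <= N.
Proof.
move=> cK K1 K2; have [|N N0 HN] := @compact_bound R _ K (`[-1, 1] `*` `[-1, 1]) cK.
  by apply: compact_setX; exact: segment_compact.
exists N => // z; have [z1|z1] := lerP 1 `|z.1|; first by rewrite K1 // normr0.
have [z2|z2] := lerP 1 `|z.2|; first by rewrite K2 // normr0.
by apply: HN; split; rewrite /= in_itv /= -ler_norml ltW.
Qed.

(** * The radial vortex *)

(** Radial, supported in the disc of radius [e], and polynomial inside it, hence
    smooth at the centre. *)
Definition bump (R : realType) (e : R) (n : nat) (z : R * R) : R :=
  ppow n (e ^+ 2 - z.1 ^+ 2 - z.2 ^+ 2).

Lemma C1_bump (R : realType) (e : R) (n : nat) : C1 (bump e n.+2)
  (fun z => - (2 * n.+2%:R) * (z.1 * bump e n.+1 z))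
  (fun z => - (2 * n.+2%:R) * (z.2 * bump e n.+1 z)).
Proof.
have Hq := C1_add (C1_add (C1_cst (e ^+ 2))
  (C1_scale (-1) (C1_mul (C1_fst R) (C1_fst R))))
  (C1_scale (-1) (C1_mul (C1_snd R) (C1_snd R))).
have cg : continuous (fun t : R => n.+2%:R * ppow n.+1 t).
  by apply: continuous_mul; [move=> t; exact: cvg_cst | exact: continuous_ppow].
have qE z : e ^+ 2 - z.1 ^+ 2 - z.2 ^+ 2 =
    e ^+ 2 + -1 * (z.1 * z.1) + -1 * (z.2 * z.2) by ring.
apply: (C1_ext (C1_comp cg (is_derive_ppow n) Hq)) => z; rewrite /bump qE //=.
  by ring.
by ring.
Qed.

Lemma bump_x (R : realType) (e : R) (n : nat) (z : R * R) :
  0 < e -> e <= 1 -> 1 <= `|z.1| -> bump e n.+1 z = 0.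
Proof.
move=> e0 e1 z1; apply: ppow_neg.
have : 1 <= z.1 ^+ 2 by rewrite -[z.1 ^+ 2]real_normK ?num_real // exprn_ege1.
by have := sqr_ge0 z.2; nra.
Qed.

Lemma bump_y (R : realType) (e : R) (n : nat) (z : R * R) :
  0 < e -> e <= `|z.2| -> bump e n.+1 z = 0.
Proof.
move=> e0 z2; apply: ppow_neg.
have : e ^+ 2 <= z.2 ^+ 2.
  by rewrite -[z.2 ^+ 2]real_normK ?num_real // ler_pXn2r ?nnegrE // ltW.
by have := sqr_ge0 z.1; lra.
Qed.

(** The stream function of the vortex.  The power six leaves enough derivatives for
    the gradient of the vorticity [vort] to be C1.  Both gradients are radial:
    [vortex_x], [vortex_y] and [vort_x], [vort_y] are [z.1], [z.2] times functions
    of the distance to the origin, which is why the vortex is steady. *)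
Definition vortex (R : realType) (e : R) : R * R -> R := bump e 6.
Definition vortex_x (R : realType) (e : R) (z : R * R) : R :=
  - 12 * (z.1 * bump e 5 z).
Definition vortex_y (R : realType) (e : R) (z : R * R) : R :=
  - 12 * (z.2 * bump e 5 z).
Definition vortex_xx (R : realType) (e : R) (z : R * R) : R :=
  - 12 * bump e 5 z + 120 * (z.1 ^+ 2 * bump e 4 z).
Definition vortex_xy (R : realType) (e : R) (z : R * R) : R :=
  120 * (z.1 * z.2 * bump e 4 z).
Definition vortex_yy (R : realType) (e : R) (z : R * R) : R :=
  - 12 * bump e 5 z + 120 * (z.2 ^+ 2 * bump e 4 z).
Definition vort (R : realType) (e : R) (z : R * R) : R :=
  vortex_xx e z + vortex_yy e z.
Definition vort_r (R : realType) (e : R) (z : R * R) : R :=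
  480 * bump e 4 z - 960 * ((z.1 ^+ 2 + z.2 ^+ 2) * bump e 3 z).
Definition vort_x (R : realType) (e : R) (z : R * R) : R := z.1 * vort_r e z.
Definition vort_y (R : realType) (e : R) (z : R * R) : R := z.2 * vort_r e z.

Lemma C1_vortex (R : realType) (e : R) : C1 (vortex e) (vortex_x e) (vortex_y e).
Proof.
by apply: (C1_ext (C1_bump e 4)) => z //; rewrite /vortex_x /vortex_y; ring.
Qed.

Lemma C1_vortex_x (R : realType) (e : R) : C1 (vortex_x e) (vortex_xx e) (vortex_xy e).
Proof.
apply: (C1_ext (C1_scale (- 12) (C1_mul (C1_fst R) (C1_bump e 3)))) => z //=;
  by rewrite /vortex_xx /vortex_xy; ring.
Qed.

Lemma C1_vortex_y (R : realType) (e : R) : C1 (vortex_y e) (vortex_xy e) (vortex_yy e).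
Proof.
apply: (C1_ext (C1_scale (- 12) (C1_mul (C1_snd R) (C1_bump e 3)))) => z //=;
  by rewrite /vortex_yy /vortex_xy; ring.
Qed.

Lemma C1_vort (R : realType) (e : R) : C1 (vort e) (vort_x e) (vort_y e).
Proof.
have sq := C1_add (C1_mul (C1_fst R) (C1_fst R)) (C1_mul (C1_snd R) (C1_snd R)).
apply: (C1_ext (C1_add (C1_scale (- 24) (C1_bump e 3))
  (C1_scale 120 (C1_mul sq (C1_bump e 2))))) => z;
  by rewrite /vort /vortex_xx /vortex_yy /vort_x /vort_y /vort_r /=; ring.
Qed.

Lemma C1_vort_xy (R : realType) (e : R) : exists vxx vxy vyy : R * R -> R,
  [/\ C1 (vort_x e) vxx vxy, C1 (vort_y e) vxy vyy &
    forall z, (forall n, bump e n.+1 z = 0) ->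
      [/\ vxx z = 0, vxy z = 0 & vyy z = 0]].
Proof.
have sq := C1_add (C1_mul (C1_fst R) (C1_fst R)) (C1_mul (C1_snd R) (C1_snd R)).
pose r' z := - 5760 * bump e 3 z + 5760 * ((z.1 ^+ 2 + z.2 ^+ 2) * bump e 2 z).
have Hr : C1 (vort_r e) (fun z => z.1 * r' z) (fun z => z.2 * r' z).
  apply: (C1_ext (C1_add (C1_scale 480 (C1_bump e 2))
    (C1_scale (- 960) (C1_mul sq (C1_bump e 1))))) => z;
    by rewrite /vort_r /r' /=; ring.
exists (fun z => vort_r e z + z.1 ^+ 2 * r' z), (fun z => z.1 * z.2 * r' z),
  (fun z => vort_r e z + z.2 ^+ 2 * r' z); split.
- by apply: (C1_ext (C1_mul (C1_fst R) Hr)) => z; rewrite /vort_x /=; ring.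
- by apply: (C1_ext (C1_mul (C1_snd R) Hr)) => z; rewrite /vort_y /=; ring.
- by move=> z b0; rewrite /vort_r /r' !b0 !mulr0 subr0 addr0 !mulr0 addr0.
Qed.

(** * The travelling wave *)

Lemma C1_shear (R : realType) (e : R) (k : nat) : 0 < e ->
  C1 (fun z => shear e k.+2 z.2) (fun=> 0) (fun z => shear e k.+1 z.2).
Proof.
move=> e0; apply: (C1_ext (C1_comp (@continuous_shear R e k.+1)
  (fun t => is_derive_shear k t e0) (C1_snd R))) => z //=.
  by rewrite mulr0.
by rewrite mulr1.
Qed.

(** A convenient way of saying that [K] vanishes off the open disc of radius [e]. *)
Definition bump_supported (R : realType) (e : R) (K : R * R -> R) : Prop :=
  forall z, (forall n, bump e n.+1 z = 0) -> K z = 0.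

Lemma bump_supported_x (R : realType) (e : R) (K : R * R -> R) :
  0 < e -> e <= 1 -> bump_supported e K -> x_supported K.
Proof. by move=> e0 e1 K0 z z1; apply: K0 => n; exact: bump_x. Qed.

Lemma bump_supported_y (R : realType) (e : R) (K : R * R -> R) (z : R * R) :
  0 < e -> bump_supported e K -> e <= `|z.2| -> perx K z = 0.
Proof. by move=> e0 K0 z2; apply: K0 => n; exact: bump_y. Qed.

Lemma bump_supported_bounded (R : realType) (e : R) (K : R * R -> R) :
  0 < e -> e <= 1 -> bump_supported e K -> continuous K ->
  exists2 N, 0 <= N & forall z, `|K z| <= N.
Proof.
move=> e0 e1 K0 cK; apply: bounded_of_support => //.
  exact: bump_supported_x K0.
by move=> z z2; apply: K0 => n; apply: bump_y => //; exact: le_trans z2.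
Qed.

Lemma vortex_supported (R : realType) (e : R) :
  [/\ bump_supported e (vortex e), bump_supported e (vortex_x e),
      bump_supported e (vortex_y e), bump_supported e (vortex_xx e) &
   [/\ bump_supported e (vortex_xy e), bump_supported e (vortex_yy e),
       bump_supported e (vort e), bump_supported e (vort_x e) &
       bump_supported e (vort_y e)]].
Proof.
split; last split; move=> z b0; rewrite /vort /vort_x /vort_y /vort_r /vortex;
  rewrite /vortex_x /vortex_y /vortex_xx /vortex_xy /vortex_yy ?b0;
  by rewrite ?mulr0 ?(addr0, subr0, mulr0).
Qed.

(** In the strip [`|y| < e] the flattened flow has constant velocity [- c], so
    that it is at rest in the frame of speed parameter [c], and the radial vortex,
    rescaled by [d], can be inserted there.  Outside the strip nothing depends on
    [x]. *)
Lemma traveling_wave_near_Poiseuille (R : realType) (e : R) :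
  0 < e -> e <= 1 / 4 ->
  exists (om g1 g2 : R * R -> R) (lam : R),
    [/\ W1infty om, nontrivial_traveling_wave om lam, `|lam| <= 1 &
      [/\ C1 (fun z => om z + 2 * z.2) g1 g2,
          xperiodic (fun z => om z + 2 * z.2) &
          concentrated 10 e (fun z => om z + 2 * z.2) g1 g2]].
Proof.
move=> e0 e4; have e1 : e <= 1 by lra.
have [vxx [vxy [vyy [Hvx Hvy vv0]]]] := C1_vort_xy e.
have [zV zVx zVy zVxx [zVxy zVyy zW zWx zWy]] := vortex_supported e.
have [zvxx zvxy zvyy] :
    [/\ bump_supported e vxx, bump_supported e vxy & bump_supported e vyy].
  by split=> z /vv0 [].
have sx K := @bump_supported_x R e K e0 e1.
have sy K z := @bump_supported_y R e K z e0.
have [C0 Cx Cy _] := C1_vort e; have [_ Cxx Cxy _] := Hvx; have [_ _ Cyy _] := Hvy.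
have [N0 N00 HN0] := bump_supported_bounded e0 e1 zW C0.
have [N1 N10 HN1] := bump_supported_bounded e0 e1 zWx Cx.
have [N2 N20 HN2] := bump_supported_bounded e0 e1 zWy Cy.
have [N3 N30 HN3] := bump_supported_bounded e0 e1 zvxx Cxx.
have [N4 N40 HN4] := bump_supported_bounded e0 e1 zvxy Cxy.
have [N5 N50 HN5] := bump_supported_bounded e0 e1 zvyy Cyy.
(* the amplitude [d] makes the vorticity of the vortex and its derivatives up to
   order two at most [e] *)
pose N := N0 + N1 + N2 + N3 + N4 + N5 + 1.
have Npos : 0 < N by rewrite /N; lra.
pose d := e / N.
have d0 : 0 < d by rewrite divr_gt0.
have small (K : R * R -> R) n : (forall z, `|K z| <= n) -> n <= N ->
    forall z, `|d * perx K z| <= e.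
  move=> Kn nN z; rewrite normrM gtr0_norm // /d mulrAC ler_pdivrMr //.
  by apply: ler_wpM2l; [exact: ltW | exact: le_trans (Kn _) nN].
have b0 := small _ _ HN0 (ltac:(rewrite /N; lra)).
have b1 := small _ _ HN1 (ltac:(rewrite /N; lra)).
have b2 := small _ _ HN2 (ltac:(rewrite /N; lra)).
have b3 := small _ _ HN3 (ltac:(rewrite /N; lra)).
have b4 := small _ _ HN4 (ltac:(rewrite /N; lra)).
have b5 := small _ _ HN5 (ltac:(rewrite /N; lra)).
(* the value that gives [Psi] its boundary values, [shear e 4] being odd *)
pose c := - (1 / 3) + 2 * shear e 4 1.
have HV := C1_scale d (C1_perx (C1_vortex e) (sx _ zV) (sx _ zVx) (sx _ zVy)).
have HVx := C1_scale d (C1_perx (C1_vortex_x e) (sx _ zVx) (sx _ zVxx) (sx _ zVxy)).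
have HVy := C1_scale d (C1_perx (C1_vortex_y e) (sx _ zVy) (sx _ zVxy) (sx _ zVyy)).
have HW := C1_scale d (C1_perx (C1_vort e) (sx _ zW) (sx _ zWx) (sx _ zWy)).
have HWx := C1_scale d (C1_perx Hvx (sx _ zWx) (sx _ zvxx) (sx _ zvxy)).
have HWy := C1_scale d (C1_perx Hvy (sx _ zWy) (sx _ zvxy) (sx _ zvyy)).
pose Psi z := - 2 * shear e 4 z.2 + c * z.2 + d * perx (vortex e) z.
pose Px z := d * perx (vortex_x e) z.
pose Py z := - 2 * shear e 3 z.2 + c + d * perx (vortex_y e) z.
pose Pxx z := d * perx (vortex_xx e) z.
pose Pxy z := d * perx (vortex_xy e) z.
pose Pyy z := - 2 * shear e 2 z.2 + d * perx (vortex_yy e) z.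
pose wx z := d * perx (vort_x e) z.
pose wy z := - 2 * shear e 1 z.2 + d * perx (vort_y e) z.
have HP : C1 Psi Px Py.
  apply: (C1_ext (C1_add (C1_add (C1_scale (- 2) (C1_shear 2 e0))
    (C1_scale c (C1_snd R))) HV)) => z //=.
    by rewrite /Px; ring.
  by rewrite /Py; ring.
have HPy : C1 Py Pxy Pyy.
  apply: (C1_ext (C1_add (C1_add (C1_scale (- 2) (C1_shear 1 e0))
    (C1_cst c)) HVy)) => z //=.
    by rewrite /Pxy; ring.
  by rewrite /Pyy; ring.
have wE z : Pxx z + Pyy z = - 2 * shear e 2 z.2 + d * perx (vort e) z.
  by rewrite /Pxx /Pyy /perx /vort; ring.
have Hw : C1 (fun z => Pxx z + Pyy z) wx wy.
  apply: (C1_ext (C1_add (C1_scale (- 2) (C1_shear 0 e0)) HW)) => z //=.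
  by rewrite /wx; ring.
have pK (K : R * R -> R) := @perx_xperiodic R K.
have pPsi : xperiodic Psi by move=> x y; rewrite /Psi pK.
have pw : xperiodic (fun z => Pxx z + Pyy z) by move=> x y; rewrite !wE pK.
have Psi_bd x : Psi (x, 1) = - (1 / 3) /\ Psi (x, -1) = 1 / 3.
  have v0 y : `|y| = 1 -> perx (vortex e) (x, y) = 0.
    by move=> y1; apply: sy => //=; rewrite y1.
  have [v1 vN1] : perx (vortex e) (x, 1) = 0 /\ perx (vortex e) (x, -1) = 0.
    by split; apply: v0; rewrite ?normrN1 ?normr1.
  rewrite /Psi v1 vN1 /= mulr0 !addr0.
  rewrite shear_odd4 /c; split; first by ring.
  by field.
have stat z : (c - Py z) * wx z + Px z * wy z = 0.
  have [ze|ze] := lerP e `|z.2|.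
    by rewrite /wx /Px !sy // !mulr0 mul0r addr0.
  rewrite /Py /wx /Px /wy !shear_flat ?(ltW ze) //.
  by rewrite /perx /vort_x /vort_y /vortex_x /vortex_y /=; ring.
have Hsol := traveling_wave HP HVx HPy Hw pPsi Psi_bd stat.
exists (fun z => Pxx z + Pyy z), wx, (fun z => wy z + 2), c; split.
- exact: W1infty_C1 Hw pw.
- exists (fun t z => (- Py (z.1 + c * t, z.2), Px (z.1 + c * t, z.2))); split=> //.
  (* compare the axis through the centre of the vortex with a point at rest *)
  move=> sf; have := sf 0 pi 0 (e / 2) (lexx 0).
  have pi0 := pi_gt0 R; have pi2 := pi_ge2 R.
  rewrite /= mulr0 !addr0 /Py /= /perx /=.
  rewrite (xred_floor (x := pi) (n := 0)); last by apply/andP; split; lra.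
  rewrite (xred_floor (x := 0) (n := 0)); last by apply/andP; split; lra.
  rewrite mulr0 !subr0 subrr.
  have -> : vortex_y e (0 - pi, e / 2) = 0.
    by apply: (sx _ zVy); rewrite /= sub0r normrN ger0_norm; lra.
  have v0 : vortex_y e (0, e / 2) != 0.
    rewrite /vortex_y mulf_neq0 ?oppr_eq0 ?pnatr_eq0 //.
    rewrite mulf_neq0 //=; first by rewrite gt_eqF // divr_gt0.
    by rewrite /bump /= ppow_pos; [rewrite expf_neq0 // gt_eqF // | ]; nra.
  move=> H; have : d * vortex_y e (0, e / 2) = 0.
    by move: (H (ltac:(by apply/andP; split; lra))); lra.
  by apply/eqP; rewrite mulf_neq0 // gt_eqF.
- have /andP[? ?] := shear4_1_range e0 e4.
  by rewrite /c ler_norml; apply/andP; split; lra.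
have fE z : Pxx z + Pyy z + 2 * z.2 = - 2 * (shear e 2 z.2 - z.2) + d * perx (vort e) z.
  by rewrite wE; ring.
split.
- apply: (C1_ext (C1_add Hw (C1_scale 2 (C1_snd R)))) => z //=; first by ring.
  by ring.
- by move=> x y; rewrite !fE pK.
have dy_le z w : cell R z -> cell R w -> `|z.2 - w.2| <= channel_dist z w.
  by move=> cz cw; have [] := channel_dist_shift cz cw.
have dist0 (z w : R * R) := channel_dist_ge0 z w.
have lip (K Kx Ky : R * R -> R) z w : C1 K Kx Ky -> xperiodic K ->
    (forall z, `|Kx z| <= e) -> (forall z, `|Ky z| <= e) ->
    cell R z -> cell R w -> `|K z - K w| <= 2 * e * channel_dist z w.
  by move=> HK pfK Kx1 Ky1; exact: C1_channel_lipschitz HK pfK Kx1 Ky1.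
have dpK (K : R * R -> R) : xperiodic (fun z => d * perx K z).
  by move=> x y; rewrite pK.
have two_mul (x : R) : `|- 2 * x| = 2 * `|x|.
  by rewrite normrM normrN (@gtr0_norm _ 2).
have ei : 4 <= e^-1 by rewrite -[e^-1]mul1r ler_pdivlMr //; lra.
split.
- move=> z _; rewrite fE; apply: le_trans (ler_normD _ _) _.
  rewrite two_mul; have := b0 z; have := shear2_close z.2 e0.
  by lra.
- move=> z w cz cw; rewrite !fE.
  rewrite (_ : _ - _ = - 2 * ((shear e 2 z.2 - z.2) - (shear e 2 w.2 - w.2)) +
    (d * perx (vort e) z - d * perx (vort e) w)); last by ring.
  apply: le_trans (ler_normD _ _) _; rewrite two_mul.
  have := lip _ _ _ _ _ HW (dpK _) b1 b2 cz cw.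
  have := shear2_lipschitz z.2 w.2 e0; have := dy_le z w cz cw.
  move: (dist0 z w) => *; nra.
move=> g [->|->]; split.
- by move=> z _; apply: le_trans (b1 z) _; lra.
- move=> z w cz cw; have := lip _ _ _ _ _ HWx (dpK _) b3 b4 cz cw.
  by rewrite -/(wx z) -/(wx w); move: (dist0 z w) => *; nra.
- by move=> z _ ze; rewrite /wx sy ?mulr0 //; lra.
- move=> z _; have := b2 z; have /andP[? ?] := shear1_range z.2 e0.
  by rewrite !ler_norml /wy => /andP[? ?]; apply/andP; split; lra.
- move=> z w cz cw.
  rewrite (_ : _ - _ = - 2 * (shear e 1 z.2 - shear e 1 w.2) +
    (d * perx (vort_y e) z - d * perx (vort_y e) w)); last by rewrite /wy; ring.
  apply: le_trans (ler_normD _ _) _; rewrite two_mul.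
  have := lip _ _ _ _ _ HWy (dpK _) b4 b5 cz cw.
  have := shear1_lipschitz z.2 w.2 e0; have := dy_le z w cz cw.
  move: (dist0 z w) => dz dyz s1 l2.
  have : 4 / e * `|z.2 - w.2| <= 4 / e * channel_dist z w.
    by rewrite ler_wpM2l // divr_ge0 // ltW.
  nra.
- move=> z _ ze; rewrite /wy shear1_outside ?(ltW ze) // sy //; last by lra.
  by rewrite mulr0 addr0; ring.
Qed.

Theorem theorem1p1 (R : realType) (s : R) (hs0 : 0 <= s) (hs : s < 3 / 2) :
  exists C : R, forall eps : R, 0 < eps ->
    exists (omega : R * R -> R) (lambda : R),
      [/\ W1infty omega,
          nontrivial_traveling_wave omega lambda,
          (Hs_norm s (fun z => (omega z + 2 * z.2)%R) < eps%:E)%E &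
          `|lambda| <= C].
Proof.
exists 1 => eps eps0.
have [e0 e00 He] := @Hs_norm_small R s 10 eps hs0 hs (ltr0Sn _ _) eps0.
pose e := Num.min e0 (1 / 4).
have e_gt0 : 0 < e by rewrite lt_min e00 divr_gt0.
have ee0 : e <= e0 by rewrite ge_min lexx.
have e4 : e <= 1 / 4 by rewrite ge_min lexx orbT.
have [om [g1 [g2 [lam [W tw lam1 [Hf pf Hc]]]]]] :=
  traveling_wave_near_Poiseuille e_gt0 e4.
exists om, lam; split=> //; apply: He Hf pf Hc.
by rewrite e_gt0.
Qed.
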